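(* Let $p,q$ be prime numbers with $q\mid p-1$. Then there exists a semisimple Hopf algebra over $k$ of dimension $p^2q^2$ which is simple as a Hopf algebra (and which is not isomorphic to a group algebra or the dual of a group algebra).
   Context: $k$ is an algebraically closed field of characteristic zero. A Hopf algebra is simple if it has no normal Hopf subalgebras (i.e., Hopf subalgebras stable under the adjoint action ${}^hx=\sum h_1xS(h_2)$) other than $k$ and itself. *)

(* Defs.v *)
From HB Require Import structures.
From mathcomp Require Import all_boot all_order all_algebra all_fingroup.
Set Implicit Arguments. Unset Strict Implicit. Unset Printing Implicit Defensive.
Import GRing.Theory.
Local Open Scope ring_scope.

(* A finite-dimensional Hopf algebra of dimension n over F, given by its
   structure constants in a fixed basis e_0, ..., e_(n-1).
   Elements are row vectors 'rV[F]_n; an element of H (x) H is an n x n matrix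
   M, standing for \sum_(a,b) M a b e_a (x) e_b. *)
Record hopf (F : fieldType) (n : nat) := Hopf {
  hmul : 'I_n -> 'I_n -> 'rV[F]_n;
  hunit : 'rV[F]_n;
  hcomul : 'I_n -> 'M[F]_n;
  hcounit : 'I_n -> F;
  hanti : 'M[F]_n
}.

Section HopfDefs.
Variables (F : fieldType) (n : nat) (H : hopf F n).

Definition bvec (i : 'I_n) : 'rV[F]_n := delta_mx 0 i.

Definition mulv (x y : 'rV[F]_n) : 'rV[F]_n :=
  \sum_i \sum_j (x 0 i * y 0 j) *: hmul H i j.
Definition comulv (x : 'rV[F]_n) : 'M[F]_n := \sum_i x 0 i *: hcomul H i.
Definition counitv (x : 'rV[F]_n) : F := \sum_i x 0 i * hcounit H i.
Definition antiv (x : 'rV[F]_n) : 'rV[F]_n := x *m hanti H.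

Definition tens (u v : 'rV[F]_n) : 'M[F]_n := u^T *m v.

Definition tmul (M N : 'M[F]_n) : 'M[F]_n :=
  \sum_a \sum_b \sum_c \sum_d
     (M a b * N c d) *: tens (hmul H a c) (hmul H b d).

Definition is_hopf : Prop :=
  [/\
      (forall x y z, mulv (mulv x y) z = mulv x (mulv y z)) /\
      (forall x, mulv (hunit H) x = x /\ mulv x (hunit H) = x),
      (forall x (c d e : 'I_n),
          \sum_a comulv x a e * hcomul H a c d
        = \sum_b comulv x c b * hcomul H b d e) /\
      (forall x, \sum_a hcounit H a *: row a (comulv x) = x /\
                 \sum_b hcounit H b *: (col b (comulv x))^T = x),
      (forall x y, comulv (mulv x y) = tmul (comulv x) (comulv y)) /\
        comulv (hunit H) = tens (hunit H) (hunit H),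
      (forall x y, counitv (mulv x y) = counitv x * counitv y) /\
        counitv (hunit H) = 1
    &
      forall x,
        \sum_a \sum_b comulv x a b *: mulv (antiv (bvec a)) (bvec b)
          = counitv x *: hunit H /\
        \sum_a \sum_b comulv x a b *: mulv (bvec a) (antiv (bvec b))
          = counitv x *: hunit H].

(* Subspaces of H are represented by matrices (their row spaces). *)
Definition left_ideal (I : 'M[F]_n) : Prop :=
  forall x y, (y <= I)%MS -> (mulv x y <= I)%MS.

Definition semisimple : Prop :=
  forall I, left_ideal I ->
    exists J, left_ideal J /\ (I :&: J)%MS == 0 /\ (I + J == 1%:M)%MS.

(* Hopf subalgebra: subalgebra (containing 1), subcoalgebra
   (Delta B <= B (x) B, i.e. all rows and columns of Delta b lie in B),
   stable under the antipode. *)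
Definition hopf_subalg (B : 'M[F]_n) : Prop :=
  [/\ (hunit H <= B)%MS,
      (forall x y, (x <= B)%MS -> (y <= B)%MS -> (mulv x y <= B)%MS),
      (forall x, (x <= B)%MS -> (comulv x <= B)%MS /\ ((comulv x)^T <= B)%MS)
    & (forall x, (x <= B)%MS -> (antiv x <= B)%MS)].

Definition adv (h x : 'rV[F]_n) : 'rV[F]_n :=
  \sum_a \sum_b comulv h a b *: mulv (mulv (bvec a) x) (antiv (bvec b)).

Definition normal_sub (B : 'M[F]_n) : Prop :=
  forall h x, (x <= B)%MS -> (adv h x <= B)%MS.

Definition simple_hopf : Prop :=
  forall B, hopf_subalg B -> normal_sub B ->
    (B == hunit H)%MS \/ (B == 1%:M)%MS.

End HopfDefs.

Definition hopf_iso (F : fieldType) (n : nat) (H H' : hopf F n) : Prop :=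
  exists P : 'M[F]_n, P \in unitmx /\
    (forall x y, mulv H' (x *m P) (y *m P) = mulv H x y *m P) /\
    hunit H *m P = hunit H' /\
    (forall x, comulv H' (x *m P) = P^T *m comulv H x *m P) /\
    (forall x, counitv H' (x *m P) = counitv H x) /\
    (forall x, antiv H' (x *m P) = antiv H x *m P).

Definition groupalg (F : fieldType) (n : nat) (gT : finGroupType)
  (f : 'I_n -> gT) : hopf F n :=
  @Hopf F n (fun i j => \row_k ((f k == (f i * f j)%g) : nat)%:R)
    (\row_k ((f k == 1%g) : nat)%:R)
    (fun i => \matrix_(a, b) (((a == i) && (b == i)) : nat)%:R)
    (fun _ => 1)
    (\matrix_(i, k) ((f k == (f i)^-1%g) : nat)%:R).

Definition dualgroupalg (F : fieldType) (n : nat) (gT : finGroupType)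
  (f : 'I_n -> gT) : hopf F n :=
  @Hopf F n (fun i j => \row_k (((k == i) && (k == j)) : nat)%:R)
    (\row_k 1)
    (fun i => \matrix_(a, b) ((f a * f b == f i)%g : nat)%:R)
    (fun i => ((f i == 1%g) : nat)%:R)
    (\matrix_(i, k) ((f k == (f i)^-1%g) : nat)%:R).

Definition is_group_algebra (F : fieldType) (n : nat) (H : hopf F n) : Prop :=
  exists (gT : finGroupType) (f : 'I_n -> gT),
    bijective f /\ hopf_iso (groupalg F f) H.

Definition is_dual_group_algebra (F : fieldType) (n : nat) (H : hopf F n)
  : Prop :=
  exists (gT : finGroupType) (f : 'I_n -> gT),
    bijective f /\ hopf_iso (dualgroupalg F f) H.

(* Main.v *)
(** Let X be the group of maps x |-> w^i x + b of F_p, with w of order q, and let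
    G = X * X, with t_1, t_2 the translations by 1 and s_1, s_2 the multiplications
    by w in the two factors.  The Hopf algebra H is the group algebra kG with
    comultiplication twisted by J, the nondegenerate bicharacter of
    <s_1, s_2> = Z_q * Z_q viewed as an element of kG (x) kG.

    Let B be a normal Hopf subalgebra of H.  The functional lam : x |-> x(1), a
    multiple of the regular character of kG, is an integral of the dual of H; it
    restricts to a nondegenerate trace form on B, and this yields an idempotent
    integral e of B.  Normality makes e central in kG, whence e is the averaging
    idempotent of a normal subgroup N of G, and B consists of the coinvariants of
    H -> He, on either side.  If t_1 lies in N, it is coinvariant on one side,
    because it commutes with s_2, so it lies in B and is coinvariant on the other
    side as well; as it does not commute with s_1, this forces s_2 to lie in N.
    Then t_2 lies in N, so s_1 does by symmetry, and so on: either N is trivial and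
    B = k, or N = G and B = H. *)
From HB Require Import structures.
Require Import Defs.
From mathcomp Require Import all_boot all_order all_algebra all_fingroup.
From mathcomp Require Import all_solvable all_character.
Set Implicit Arguments. Unset Strict Implicit. Unset Printing Implicit Defensive.
Import GRing.Theory.
Local Open Scope ring_scope.

(** * Group algebras *)

(** Only the additive structure of functions is inherited, so that the ring structure can be the
    convolution product. *)
Definition galg (F : fieldType) (G : finGroupType) := {ffun G -> F}.
HB.instance Definition _ (F : fieldType) (G : finGroupType) :=
  GRing.Zmodule.on (galg F G).

Section GroupAlgebra.
Variables (F : fieldType) (G : finGroupType).
Implicit Types (g h : G) (x y u : galg F G).

Definition gb g : galg F G := [ffun k => (k == g)%:R].

Definition gmul x y : galg F G := [ffun k => \sum_h x h * y (h^-1 * k)%g].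

Lemma gaddE x y g : (x + y) g = x g + y g. Proof. by rewrite ffunE. Qed.

Definition gscale (a : F) x : galg F G := [ffun k => a * x k].
Fact gscaleA a b x : gscale a (gscale b x) = gscale (a * b) x.
Proof. by apply/ffunP=> k; rewrite !ffunE mulrA. Qed.
Fact gscale1 : left_id 1 gscale.
Proof. by move=> x; apply/ffunP=> k; rewrite ffunE mul1r. Qed.
Fact gscaleDr : right_distributive gscale +%R.
Proof. by move=> a x y; apply/ffunP=> k; rewrite !ffunE mulrDr. Qed.
Fact gscaleDl x : {morph gscale^~ x : a b / a + b}.
Proof. by move=> a b; apply/ffunP=> k; rewrite !ffunE mulrDl. Qed.
HB.instance Definition _ := GRing.Zmodule_isLmodule.Build F (galg F G)
  gscaleA gscale1 gscaleDr gscaleDl.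

Lemma gscaleE a x g : (a *: x) g = a * x g. Proof. by rewrite ffunE. Qed.

Lemma gmulA : associative gmul.
Proof.
move=> x y u; apply/ffunP=> k; rewrite !ffunE.
under eq_bigr => h _ do rewrite ffunE mulr_sumr.
under [RHS]eq_bigr => h _ do rewrite ffunE mulr_suml.
rewrite [RHS]exchange_big /=; apply: eq_bigr => h _.
rewrite [RHS](reindex_inj (mulgI h)) /=; apply: eq_bigr => l _.
by rewrite mulrA invMg mulgA mulKg.
Qed.

Lemma gmul1x : left_id (gb 1) gmul.
Proof.
move=> x; apply/ffunP=> k; rewrite ffunE (bigD1 1%g) //= ffunE eqxx mul1r.
rewrite big1 ?addr0 ?invg1 ?mul1g // => h /negPf nh; by rewrite ffunE nh mul0r.
Qed.

Lemma gmulx1 : right_id (gb 1) gmul.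
Proof.
move=> x; apply/ffunP=> k; rewrite ffunE (bigD1 k) //= ffunE mulVg eqxx mulr1.
rewrite big1 ?addr0 // => h nh; rewrite ffunE -eq_mulVg1 (negPf nh) mulr0 //.
Qed.

Lemma gmulDl : left_distributive gmul +%R.
Proof.
move=> x y u; apply/ffunP=> k; rewrite !ffunE -big_split /=.
by apply: eq_bigr => h _; rewrite ffunE mulrDl.
Qed.

Lemma gmulDr : right_distributive gmul +%R.
Proof.
move=> x y u; apply/ffunP=> k; rewrite !ffunE -big_split /=.
by apply: eq_bigr => h _; rewrite ffunE mulrDr.
Qed.

Lemma gb1_neq0 : gb 1 != 0.
Proof. by apply/eqP => /ffunP/(_ 1%g)/eqP; rewrite !ffunE eqxx oner_eq0. Qed.

HB.instance Definition _ := GRing.Zmodule_isNzRing.Build (galg F G)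
  gmulA gmul1x gmulx1 gmulDl gmulDr gb1_neq0.

Lemma gmulE x y k : (x * y) k = \sum_h x h * y (h^-1 * k)%g.
Proof. by rewrite ffunE. Qed.

Lemma gscalAl (a : F) x y : a *: (x * y) = (a *: x) * y.
Proof.
apply/ffunP=> k; rewrite gscaleE !gmulE mulr_sumr.
by apply: eq_bigr => h _; rewrite gscaleE mulrA.
Qed.
HB.instance Definition _ :=
  GRing.Lmodule_isLalgebra.Build F (galg F G) gscalAl.

Lemma gscalAr (a : F) x y : a *: (x * y) = x * (a *: y).
Proof.
apply/ffunP=> k; rewrite gscaleE !gmulE mulr_sumr.
by apply: eq_bigr => h _; rewrite gscaleE mulrCA.
Qed.
HB.instance Definition _ :=
  GRing.Lalgebra_isAlgebra.Build F (galg F G) gscalAr.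

Lemma gbE g k : gb g k = (k == g)%:R. Proof. by rewrite ffunE. Qed.

Lemma gsumE I (r : seq I) (P : pred I) (f : I -> galg F G) k :
  (\sum_(i <- r | P i) f i) k = \sum_(i <- r | P i) f i k.
Proof. by elim/big_rec2: _ => [|i y z _ <-]; rewrite ffunE. Qed.

Lemma gb1 : gb 1 = 1. Proof. by []. Qed.

Lemma gbM g h : gb (g * h) = gb g * gb h.
Proof.
apply/ffunP=> k; rewrite gmulE (bigD1 g) //= big1 => [|l nl]; last first.
  by rewrite gbE (negPf nl) mul0r.
by rewrite addr0 !gbE eqxx mul1r (canF_eq (mulKVg g)).
Qed.

Lemma gbX g n : gb (g ^+ n)%g = gb g ^+ n.
Proof. by elim: n => // n IH; rewrite expgS exprS gbM IH. Qed.

Lemma gbV g : gb g * gb g^-1 = 1. Proof. by rewrite -gbM mulgV. Qed.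
Lemma gbVl g : gb g^-1 * gb g = 1. Proof. by rewrite -gbM mulVg. Qed.

Lemma gb_sum x : x = \sum_g x g *: gb g.
Proof.
apply/ffunP=> k; rewrite gsumE (bigD1 k) //= big1 => [|h nh].
  by rewrite addr0 gscaleE gbE eqxx mulr1.
by rewrite gscaleE gbE eq_sym (negPf nh) mulr0.
Qed.

Lemma gbmulE g x k : (gb g * x) k = x (g^-1 * k)%g.
Proof.
rewrite gmulE (bigD1 g) //= big1 => [|l nl]; last by rewrite gbE (negPf nl) mul0r.
by rewrite addr0 gbE eqxx mul1r.
Qed.

Lemma mulgbE g x k : (x * gb g) k = x (k * g^-1)%g.
Proof.
rewrite gmulE (bigD1 (k * g^-1)%g) //= big1 => [|l nl].
  by rewrite addr0 gbE invMg invgK mulgKV eqxx mulr1.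
rewrite gbE; case: eqP => [e|_]; last by rewrite mulr0.
by case/eqP: nl; rewrite -e invMg invgK mulKVg.
Qed.

(** The coefficient at 1 is the functional lam of the overview; its symmetry makes x, y |-> lam(x y)
    a trace form. *)
Lemma gmul_tr x y : (x * y) 1%g = (y * x) 1%g.
Proof.
rewrite !gmulE (reindex_inj invg_inj) /=; apply: eq_bigr => h _.
by rewrite invgK !mulg1 mulrC.
Qed.

Lemma gmul_supp x y k : (x * y) k != 0 ->
  exists g h, [/\ x g != 0, y h != 0 & k = (g * h)%g].
Proof.
rewrite gmulE => nz; suff /existsP[g] : [exists g, x g * y (g^-1 * k)%g != 0].
  by rewrite mulf_eq0 negb_or => /andP[? ?]; exists g, (g^-1 * k)%g; rewrite mulKVg.
apply: contraR nz => /existsPn nz; rewrite big1 // => g _.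
by apply/eqP; rewrite -[_ == _]negbK.
Qed.

Definition lext (V : lmodType F) (f : G -> V) x : V := \sum_g x g *: f g.

Fact lext_linear (V : lmodType F) (f : G -> V) : linear (lext f).
Proof.
move=> a x y; rewrite /lext scaler_sumr -big_split; apply: eq_bigr => g _.
by rewrite gaddE gscaleE scalerDl scalerA.
Qed.
HB.instance Definition _ (V : lmodType F) (f : G -> V) :=
  GRing.isLinear.Build F (galg F G) V _ (lext f) (lext_linear f).

Lemma lext_gb (V : lmodType F) (f : G -> V) g : lext f (gb g) = f g.
Proof.
rewrite /lext (bigD1 g) //= big1 => [|h nh]; first by rewrite gbE eqxx scale1r addr0.
by rewrite gbE (negPf nh) scale0r.
Qed.

Lemma lin_ext (V : lmodType F) (f1 f2 : {linear galg F G -> V}) :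
  (forall g, f1 (gb g) = f2 (gb g)) -> f1 =1 f2.
Proof.
by move=> e x; rewrite (gb_sum x) !linear_sum; apply: eq_bigr => g _; rewrite !linearZ /= e.
Qed.

End GroupAlgebra.

(** * Bicharacters *)

Section Bicharacter.
Variables (F : fieldType) (q : nat) (z : F).
Hypotheses (zq : q.-primitive_root z) (qF : q%:R != 0 :> F).
Variable A : algType F.
Implicit Types X Y : A.

(* If X ^+ q = 1, this is the projector onto the eigenspace of X for z ^- a. *)
Definition idem (a : nat) X : A := q%:R^-1 *: \sum_(i < q) z ^+ (a * i) *: X ^+ i.

(** It acts as [Y ^+ a] on the eigenspace of [X] for z^-a. The expanded form [bicharE] shows the
    bicharacter (i, a) |-> z^(ia) and its symmetry, while the projectors make multiplicativity
    accessible. *)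
Definition bichar X Y : A := \sum_(a < q) idem a X * Y ^+ a.

(** Orthogonality of the characters of Z_q: off the diagonal this is a geometric series whose ratio
    differs from 1 and has q-th power 1. *)
Lemma sum_prim_root (i j : 'I_q) :
  \sum_(a < q) z ^+ (a * i) / z ^+ (a * j) = (i == j)%:R * q%:R.
Proof.
have z0 : z != 0 by rewrite (prim_root_eq0 zq) -lt0n (prim_order_gt0 zq).
case: eqVneq => [->|ij]; rewrite ?mul1r ?mul0r.
  under eq_bigr => a _ do rewrite divff ?expf_neq0 //.
  by rewrite sumr_const card_ord.
pose w := z ^+ i / z ^+ j.
have w1 : w - 1 != 0.
  rewrite subr_eq0 -(can_eq (mulfK (expf_neq0 j z0))) /w divfK ?expf_neq0 // mul1r.
  by rewrite (eq_prim_root_expr zq) !modn_small.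
apply: (mulfI w1); rewrite mulr0.
have -> : \sum_(a < q) z ^+ (a * i) / z ^+ (a * j) = \sum_(a < q) w ^+ a.
  by apply: eq_bigr => a _; rewrite /w exprMn exprVn -!exprM (mulnC i) (mulnC j).
by rewrite -subrX1 /w exprMn exprVn -!exprM !(mulnC _ q) !exprM !(prim_expr_order zq)
  !expr1n divr1 subrr.
Qed.

(** Multiplication by z^b X sends each term of the sum to the next one, and the last to the first
    because X^q = z^q = 1. *)
Lemma idem_shift b X : X ^+ q = 1 -> (z ^+ b *: X) * idem b X = idem b X.
Proof.
move=> Xq; rewrite /idem -scalerAr; congr (_ *: _).
case: (q) (prim_order_gt0 zq) Xq (prim_expr_order zq) => // n _ Xn zn.
rewrite mulr_sumr big_ord_recr /= [RHS]big_ord_recl /= addrC; congr (_ + _).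
  by rewrite -scalerAl -scalerAr scalerA -exprS -exprD addnC -mulnSr mulnC exprM Xn zn
    muln0 expr1n scale1r.
apply: eq_bigr => i _; rewrite -scalerAl -scalerAr scalerA -exprS -exprD.
by rewrite /bump /= add1n mulnS.
Qed.

Lemma expr_idem b X i : X ^+ q = 1 -> X ^+ i * idem b X = z ^- (b * i) *: idem b X.
Proof.
move=> Xq; have z0 : z != 0 by rewrite (prim_root_eq0 zq) -lt0n (prim_order_gt0 zq).
elim: i => [|i IH]; first by rewrite muln0 invr1 scale1r mul1r.
rewrite exprSr -mulrA -{1}(idem_shift b Xq) -scalerAl.
have -> : X * (z ^+ b *: (X * idem b X)) = X * idem b X.
  by rewrite scalerAl (idem_shift b Xq).
have -> : X * idem b X = z ^- b *: idem b X.
  by rewrite -{2}(idem_shift b Xq) -scalerAl scalerA mulVf ?expf_neq0 // scale1r.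
by rewrite -scalerAr IH scalerA mulnS exprD invfM.
Qed.

Lemma idemM (a b : 'I_q) X : X ^+ q = 1 ->
  idem a X * idem b X = (a == b)%:R *: idem b X.
Proof.
move=> Xq; rewrite {1}/idem -scalerAl mulr_suml.
under eq_bigr => i _ do rewrite -scalerAl (expr_idem b i Xq) scalerA.
rewrite -scaler_suml scalerA; congr (_ *: _).
under eq_bigr => i _ do rewrite (mulnC a) (mulnC b).
by rewrite sum_prim_root mulrCA mulVf ?mulr1.
Qed.

Lemma sum_idem X : \sum_(a < q) idem a X = 1.
Proof.
rewrite -scaler_sumr exchange_big /=; have q0 := prim_order_gt0 zq.
have e (i : 'I_q) : \sum_(a < q) z ^+ (a * i) *: X ^+ i
   = ((i == Ordinal q0 :> 'I_q)%:R * q%:R) *: X ^+ i.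
  rewrite -scaler_suml -sum_prim_root; congr (_ *: _).
  by apply: eq_bigr => a _; rewrite /= muln0 invr1 mulr1.
under eq_bigr => i _ do rewrite e.
rewrite (bigD1 (Ordinal q0)) // eqxx big1 => [|i /negPf->].
  by rewrite /= addr0 scalerA mul1r mulVf // scale1r.
by rewrite mul0r scale0r.
Qed.

Lemma bicharE X Y :
  bichar X Y = q%:R^-1 *: \sum_(i < q) \sum_(a < q) z ^+ (i * a) *: (X ^+ i * Y ^+ a).
Proof.
rewrite exchange_big scaler_sumr; apply: eq_bigr => a _.
rewrite /idem -scalerAl mulr_suml; congr (_ *: _); apply: eq_bigr => i _.
by rewrite -scalerAl mulnC.
Qed.

Lemma bichar_sym X Y : GRing.comm X Y -> bichar X Y = bichar Y X.
Proof.
move=> XY; rewrite !bicharE exchange_big; congr (_ *: _); apply: eq_bigr => i _.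
apply: eq_bigr => a _; rewrite mulnC; congr (_ *: _).
exact/commrX/commr_sym/commrX/commr_sym.
Qed.

Lemma bichar1 X : bichar X 1 = 1.
Proof. by rewrite -[RHS](sum_idem X); apply: eq_bigr => a _; rewrite expr1n mulr1. Qed.

Lemma comm_idem c a X : GRing.comm c X -> GRing.comm c (idem a X).
Proof.
move=> cX; rewrite /GRing.comm /idem -scalerAl -scalerAr mulr_suml mulr_sumr; congr (_ *: _).
by apply: eq_bigr => i _; rewrite -scalerAl -scalerAr (commrX i cX).
Qed.

Lemma comm_bichar c X Y : GRing.comm c X -> GRing.comm c Y -> GRing.comm c (bichar X Y).
Proof.
move=> cX cY; apply: commr_sum => a _; apply: commrM; first exact: comm_idem.
exact: commrX.
Qed.

(** By orthogonality of the projectors only the diagonal terms of the product survive, and there the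
    powers of [Y] and [Y'] multiply. *)
Lemma bicharMr X Y Y' : X ^+ q = 1 -> GRing.comm X Y -> GRing.comm Y Y' ->
  bichar X (Y * Y') = bichar X Y * bichar X Y'.
Proof.
move=> Xq XY YY'; rewrite {2}/bichar mulr_suml; apply: eq_bigr => a _.
rewrite mulr_sumr (bigD1 a) //= big1 => [|b ba].
  rewrite addr0 exprMn_comm // !mulrA; congr (_ * _); rewrite -mulrA.
  have -> : Y ^+ a * idem a X = idem a X * Y ^+ a.
    by apply/esym/commrX/commr_sym/comm_idem/commr_sym.
  by rewrite mulrA idemM // eqxx scale1r.
rewrite -mulrA (mulrA (Y ^+ a)).
have -> : Y ^+ a * idem b X = idem b X * Y ^+ a.
  by apply/esym/commrX/commr_sym/comm_idem/commr_sym.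
by rewrite !mulrA idemM // eq_sym (negPf ba) scale0r !mul0r.
Qed.

Lemma bicharMl X X' Y : Y ^+ q = 1 -> GRing.comm X Y -> GRing.comm X' Y ->
  GRing.comm X X' -> bichar (X * X') Y = bichar X Y * bichar X' Y.
Proof.
move=> Yq XY X'Y XX'.
have XXY : GRing.comm (X * X') Y by apply/commr_sym/commrM; apply: commr_sym.
by rewrite (bichar_sym XY) (bichar_sym X'Y) (bichar_sym XXY) bicharMr //; apply: commr_sym.
Qed.

End Bicharacter.

(** * Tensor products and twists *)

Section Tensor.
Variables (F : fieldType) (G1 G2 : finGroupType).
Implicit Types (x : galg F G1) (y : galg F G2).

(** The tensor product of two group algebras is realised as the group algebra of the direct product,
    which already carries the product ring structure. *)
Definition tn x y : galg F (G1 * G2)%type := [ffun k => x k.1 * y k.2].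

Lemma tnE x y a b : tn x y (a, b) = x a * y b. Proof. by rewrite ffunE. Qed.

Fact tn_linear x : linear (tn x).
Proof.
move=> a y y'; apply/ffunP=> k; rewrite gaddE gscaleE !ffunE.
by rewrite mulrDr mulrCA.
Qed.
HB.instance Definition _ x :=
  GRing.isLinear.Build F (galg F G2) (galg F (G1 * G2)%type) _ (tn x) (tn_linear x).

Definition tnr y x := tn x y.
Fact tnr_linear y : linear (tnr y).
Proof.
move=> a x x'; apply/ffunP=> k; rewrite gaddE gscaleE !ffunE.
by rewrite mulrDl mulrA.
Qed.
HB.instance Definition _ y :=
  GRing.isLinear.Build F (galg F G1) (galg F (G1 * G2)%type) _ (tnr y) (tnr_linear y).

Lemma tn_gb g h : tn (gb F g) (gb F h) = gb F (g, h).
Proof.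
by apply/ffunP=> -[a b]; rewrite tnE !gbE -natrM mulnb xpair_eqE.
Qed.

Lemma tnM x x' y y' : tn (x * x') (y * y') = tn x y * tn x' y'.
Proof.
apply/ffunP=> -[a b]; rewrite tnE !gmulE mulr_suml.
rewrite (eq_bigr (fun h => \sum_l x h * x' (h^-1 * a)%g * (y l * y' (l^-1 * b)%g))).
  rewrite pair_bigA /=; apply: eq_bigr => -[h l] _ /=.
  by rewrite tnE tnE mulrACA.
by move=> h _; rewrite mulr_sumr.
Qed.

Lemma tn11 : tn 1 1 = 1. Proof. by rewrite -!gb1 tn_gb. Qed.

Lemma tn_sum (M : galg F (G1 * G2)%type) :
  M = \sum_a \sum_b M (a, b) *: tn (gb F a) (gb F b).
Proof.
rewrite {1}(gb_sum M) pair_bigA; apply: eq_bigr => -[a b] _ /=.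
by rewrite tn_gb.
Qed.

End Tensor.

Section Gmap.
Variables (F : fieldType).

Definition gmap (G G' : finGroupType) (f : G -> G') : galg F G -> galg F G' :=
  lext (fun g => gb F (f g)).
HB.instance Definition _ G G' f := GRing.Linear.copy (@gmap G G' f) (lext (fun g => gb F (f g))).

Lemma gmap_gb (G G' : finGroupType) (f : G -> G') g : gmap f (gb F g) = gb F (f g).
Proof. exact: lext_gb. Qed.

Lemma gmap_comp (G G' G'' : finGroupType) (f : G -> G') (f' : G' -> G'') x :
  gmap f' (gmap f x) = gmap (fun g => f' (f g)) x.
Proof.
by apply: (@lin_ext _ _ _ (gmap f' \o gmap f) (gmap (fun g => f' (f g)))) => g /=;
  rewrite !gmap_gb.
Qed.

Section Morph.
Variables (G G' : finGroupType) (f : G -> G').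
Hypothesis fM : {morph f : g h / (g * h)%g}.

Lemma gmapM x y : gmap f (x * y) = gmap f x * gmap f y.
Proof.
rewrite (gb_sum x) mulr_suml !linear_sum mulr_suml; apply: eq_bigr => g _.
rewrite (gb_sum y) mulr_sumr !linear_sum mulr_sumr; apply: eq_bigr => h _.
by rewrite -scalerAr -!scalerAl -gbM !linearZ /= !gmap_gb fM gbM -scalerAr -scalerAl.
Qed.

Lemma gmap1 : gmap f 1 = 1.
Proof.
rewrite -!gb1 gmap_gb; congr gb; apply: (mulgI (f 1%g)).
by rewrite -fM !mulg1.
Qed.

Lemma gmapX x n : gmap f (x ^+ n) = gmap f x ^+ n.
Proof. by elim: n => [|n IH]; rewrite ?gmap1 // !exprS gmapM IH. Qed.

Lemma gmap_bichar q z g h :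
  gmap f (bichar q z (gb F g) (gb F h)) = bichar q z (gb F (f g)) (gb F (f h)).
Proof.
rewrite !bicharE linearZ linear_sum; congr (_ *: _); apply: eq_bigr => i _.
rewrite linear_sum; apply: eq_bigr => a _; rewrite linearZ /=; congr (_ *: _).
by rewrite gmapM !gmapX !gmap_gb.
Qed.
End Morph.

Lemma gb_comm (G : finGroupType) (g h : G) : commute g h -> GRing.comm (gb F g) (gb F h).
Proof. by rewrite /GRing.comm -!gbM => ->. Qed.

Lemma gb_expq (G : finGroupType) (g : G) q : (g ^+ q = 1)%g -> gb F g ^+ q = 1.
Proof. by rewrite -gbX => ->. Qed.

End Gmap.

Lemma pair_comm (G1 G2 : finGroupType) (a c : G1) (b d : G2) :
  commute a c -> commute b d -> commute (a, b) (c, d).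
Proof. by move=> ac bd; rewrite /commute /mulg /= /mulg /=; congr (_, _). Qed.

Lemma pairX1 (G1 G2 : finGroupType) (x : G1) n :
  ((x, 1) ^+ n = (x ^+ n, 1) :> G1 * G2)%g.
Proof. by elim: n => // n IH; rewrite !expgS IH; congr (_, _); rewrite /= mulg1. Qed.

Lemma pair1X (G1 G2 : finGroupType) (x : G2) n :
  ((1, x) ^+ n = (1, x ^+ n) :> G1 * G2)%g.
Proof. by elim: n => // n IH; rewrite !expgS IH; congr (_, _); rewrite /= mulg1. Qed.

(** * The twisting element and the twisted structure maps *)

Section Twist.
Variables (F : fieldType) (q : nat) (z : F).
Hypotheses (zq : q.-primitive_root z) (qF : q%:R != 0 :> F).
Local Notation R := (bichar q z).
Local Notation gb := (gb F).

Lemma bicharV (G : finGroupType) (x y : G) : (x ^+ q = 1)%g -> commute x y ->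
  R (gb x) (gb y) * R (gb x) (gb y^-1) = 1.
Proof.
move=> xq xy; rewrite -(bicharMr zq) ?gb_expq //; last first.
- by apply: gb_comm; apply: commuteV.
- exact: gb_comm.
by rewrite gbV (bichar1 zq).
Qed.

Lemma bicharVl (G : finGroupType) (x y : G) : (x ^+ q = 1)%g -> commute x y ->
  R (gb x) (gb y^-1) * R (gb x) (gb y) = 1.
Proof. by move=> xq xy; rewrite -{2}(invgK y) bicharV //; apply: commuteV. Qed.

(** The 2-cocycle identity for J, with the index marking the tensor leg. By multiplicativity both
    sides are products of R x1 y2, R x1 y3 and R x2 y3, and the last commutes with the other two. *)
Lemma bichar_cocycle (A : algType F) (x1 x2 y2 y3 : A) :
  x1 ^+ q = 1 -> y3 ^+ q = 1 ->
  GRing.comm x1 x2 -> GRing.comm x1 y2 -> GRing.comm x1 y3 ->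
  GRing.comm x2 y2 -> GRing.comm x2 y3 -> GRing.comm y2 y3 ->
  R x1 y2 * R (x1 * x2) y3 = R x2 y3 * R x1 (y2 * y3).
Proof.
move=> x1q y3q c12 c1y2 c1y3 c2y2 c2y3 cy; rewrite (bicharMl zq) // (bicharMr zq) //.
rewrite mulrA; apply: comm_bichar.
all: apply/commr_sym/commrM; apply: comm_bichar => //; exact: commr_sym.
Qed.

Lemma bichar_cocycle_rev (A : algType F) (x1 x2 y2 y3 : A) :
  x1 ^+ q = 1 -> y3 ^+ q = 1 ->
  GRing.comm x1 x2 -> GRing.comm x1 y2 -> GRing.comm x1 y3 ->
  GRing.comm x2 y2 -> GRing.comm x2 y3 -> GRing.comm y2 y3 ->
  R (x1 * x2) y3 * R x1 y2 = R x1 (y2 * y3) * R x2 y3.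
Proof.
move=> x1q y3q c12 c1y2 c1y3 c2y2 c2y3 cy.
have -> : R (x1 * x2) y3 * R x1 y2 = R x1 y2 * R (x1 * x2) y3.
  apply/commr_sym; apply: comm_bichar; apply/commr_sym.
    by apply: comm_bichar; apply/commr_sym/commrM; apply/commr_sym.
  by apply: comm_bichar => //; apply/commr_sym.
rewrite bichar_cocycle //; apply/commr_sym.
apply: comm_bichar; apply/commr_sym; first last.
  by apply: comm_bichar; [apply: commr_sym | apply: commrM => //; apply: commr_sym].
by apply: comm_bichar; [apply: commr_sym | apply: commrM].
Qed.

Variables (G : finGroupType) (s1 s2 : G).
Hypotheses (s1q : (s1 ^+ q = 1)%g) (s2q : (s2 ^+ q = 1)%g) (s12 : commute s1 s2).

Definition twJ : galg F (G * G)%type := R (gb (s1, 1%g)) (gb (1%g, s2)).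
Definition twK : galg F (G * G)%type := R (gb (s1, 1%g)) (gb (1%g, s2^-1%g)).

Definition dg : galg F G -> galg F (G * G)%type := gmap (fun g => (g, g)).
HB.instance Definition _ := GRing.Linear.copy dg (gmap (fun g => (g, g))).
Definition twD x := twJ * dg x * twK.
Fact twD_linear : linear twD.
Proof.
by move=> a x y; rewrite /twD linearD linearZ /= mulrDr mulrDl -scalerAr -scalerAl.
Qed.
HB.instance Definition _ :=
  GRing.isLinear.Build F (galg F G) (galg F (G * G)%type) _ twD twD_linear.

Definition ginv : galg F G -> galg F G := lext (fun g => gb g^-1).
HB.instance Definition _ := GRing.Linear.copy ginv (lext (fun g => gb g^-1)).
(* twQ = J_1 S(J_2), and twP is its inverse. *)
Definition twQ : galg F G := R (gb s1) (gb s2^-1).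
Definition twP : galg F G := R (gb s1) (gb s2).
Definition twS x := twQ * ginv x * twP.
Fact twS_linear : linear twS.
Proof.
by move=> a x y; rewrite /twS linearD linearZ /= mulrDr mulrDl -scalerAr -scalerAl.
Qed.
HB.instance Definition _ := GRing.isLinear.Build F (galg F G) (galg F G) _ twS twS_linear.

Definition geps (x : galg F G) : F := \sum_g x g.
Fact geps_scalar : scalar geps.
Proof.
move=> a x y; rewrite /geps mulr_sumr -big_split; apply: eq_bigr => g _.
by rewrite gaddE gscaleE.
Qed.
HB.instance Definition _ := GRing.isLinear.Build F (galg F G) F *%R geps geps_scalar.

End Twist.

(** * Counit and antipode axioms for the twist *)

Section TwistTheory.
Variables (F : fieldType) (q : nat) (z : F).
Hypotheses (zq : q.-primitive_root z) (qF : q%:R != 0 :> F).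
Local Notation R := (bichar q z).
Local Notation gb := (gb F).

Lemma bichar1l (A : algType F) (Y : A) : R 1 Y = 1.
Proof. by rewrite bichar_sym ?bichar1 //; apply/commr_sym/commr1. Qed.

(** One side is a left inverse of R(x, y) and the other a right inverse. *)
Lemma bicharVV (G : finGroupType) (x y : G) : (x ^+ q = 1)%g -> (y ^+ q = 1)%g ->
  commute x y -> R (gb x^-1) (gb y) = R (gb x) (gb y^-1).
Proof.
move=> xq yq xy; rewrite -[LHS]mulr1 -(bicharV zq qF xq xy) mulrA.
rewrite -(bicharMl zq) ?gb_expq //.
- by rewrite gbVl bichar1l mul1r.
- by apply: gb_comm; apply/commute_sym/commuteV/commute_sym.
- exact: gb_comm.
by apply/commr_sym/gb_comm/commuteV.
Qed.

Variables (G : finGroupType) (s1 s2 : G).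
Hypotheses (s1q : (s1 ^+ q = 1)%g) (s2q : (s2 ^+ q = 1)%g) (s12 : commute s1 s2).
Local Notation J := (twJ q z s1 s2).
Local Notation K := (twK q z s1 s2).
Local Notation D := (twD q z s1 s2).
Local Notation S := (twS q z s1 s2).
Local Notation Q := (twQ q z s1 s2).
Local Notation P := (twP q z s1 s2).

Lemma comm_s1s2 : commute ((s1, 1%g) : (G * G)%type) (1%g, s2).
Proof. by apply: pair_comm; [apply: commute1 | apply/commute_sym/commute1]. Qed.

Lemma twJK : J * K = 1.
Proof.
rewrite /twJ /twK.
have -> : (1%g, s2^-1%g) = (1%g, s2)^-1%g :> (G * G)%type by congr (_, _); rewrite invg1.
by apply: bicharV => //; [rewrite pairX1 s1q | apply: comm_s1s2].
Qed.

Lemma twKJ : K * J = 1.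
Proof.
rewrite /twJ /twK.
have -> : (1%g, s2^-1%g) = (1%g, s2)^-1%g :> (G * G)%type by congr (_, _); rewrite invg1.
by apply: bicharVl => //; [rewrite pairX1 s1q | apply: comm_s1s2].
Qed.

Lemma twQP : Q * P = 1. Proof. exact: bicharVl. Qed.
Lemma twPQ : P * Q = 1. Proof. exact: bicharV. Qed.

Lemma dgM (x y : galg F G) : dg (x * y) = dg x * dg y. Proof. exact: gmapM. Qed.
Lemma dg1 : dg (1 : galg F G) = 1. Proof. exact: gmap1. Qed.
Lemma dg_gb (g : G) : dg (gb g) = gb (g, g). Proof. exact: gmap_gb. Qed.

Lemma twDM x y : D (x * y) = D x * D y.
Proof. by rewrite /twD dgM -!mulrA (mulrA K J) twKJ mul1r. Qed.

Lemma twD1 : D 1 = 1. Proof. by rewrite /twD dg1 mulr1 twJK. Qed.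

Lemma geps_gb (g : G) : geps (gb g) = 1.
Proof.
by rewrite /geps (bigD1 g) //= big1 => [|h /negPf hg]; rewrite ?addr0 gbE ?eqxx ?hg.
Qed.

Lemma gepsM (x y : galg F G) : geps (x * y) = geps x * geps y.
Proof.
rewrite (gb_sum x) mulr_suml !linear_sum mulr_suml; apply: eq_bigr => g _.
rewrite (gb_sum y) mulr_sumr !linear_sum mulr_sumr; apply: eq_bigr => h _.
by rewrite -scalerAr -!scalerAl -gbM !linearZ /= !geps_gb !mulr1 mulrC.
Qed.

Lemma geps1 : geps (1 : galg F G) = 1. Proof. exact: geps_gb. Qed.

(** The projection G * G -> G extends to id (x) eps ([gmap_fstE]), so this is a counit axiom. It
    holds because the projection sends both J and its inverse to a bicharacter with one argument
    1. *)
Lemma fst_twD x : gmap (fun u : G * G => u.1) (D x) = x.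
Proof.
rewrite /twD !gmapM // !gmap_bichar // !(bichar1 zq) // mul1r mulr1.
rewrite gmap_comp; apply: (@lin_ext _ _ _ (gmap id) idfun) => g.
by rewrite /= gmap_gb.
Qed.

Lemma snd_twD x : gmap (fun u : G * G => u.2) (D x) = x.
Proof.
rewrite /twD !gmapM // !gmap_bichar // /= !bichar1l // mul1r mulr1.
rewrite gmap_comp; apply: (@lin_ext _ _ _ (gmap id) idfun) => g.
by rewrite /= gmap_gb.
Qed.

Lemma gmap_fstE (M : galg F (G * G)%type) g : gmap (fun u : G * G => u.1) M g = \sum_k M (g, k).
Proof.
rewrite {1}(tn_sum M) linear_sum gsumE (bigD1 g) //= [X in _ + X]big1 => [|h hg].
  rewrite /= addr0 linear_sum gsumE; apply: eq_bigr => k _.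
  by rewrite linearZ /= tn_gb gmap_gb gscaleE gbE eqxx mulr1.
rewrite linear_sum gsumE big1 // => k _.
by rewrite linearZ /= tn_gb gmap_gb gscaleE gbE eq_sym (negPf hg) mulr0.
Qed.

Lemma gmap_sndE (M : galg F (G * G)%type) g : gmap (fun u : G * G => u.2) M g = \sum_k M (k, g).
Proof.
rewrite {1}(tn_sum M) linear_sum gsumE; apply: eq_bigr => k _.
rewrite linear_sum gsumE (bigD1 g) //= big1 => [|h hg].
  by rewrite /= addr0 linearZ /= tn_gb gmap_gb gscaleE gbE eqxx mulr1.
by rewrite linearZ /= tn_gb gmap_gb gscaleE gbE eq_sym (negPf hg) mulr0.
Qed.

Lemma twD_fst x g : \sum_k D x (g, k) = x g.
Proof. by rewrite -gmap_fstE fst_twD. Qed.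

Lemma twD_snd x g : \sum_k D x (k, g) = x g.
Proof. by rewrite -gmap_sndE snd_twD. Qed.

(* [lact x M] is the action of k[G x G] on kG by (g, h).x = g x h^-1, and
   [ract] the right action x.(g, h) = g^-1 x h; they turn the antipode axioms
   into statements about the actions of J, dg x and K. *)
Definition lact (x : galg F G) : galg F (G * G)%type -> galg F G :=
  lext (fun u : G * G => gb u.1 * x * gb u.2^-1).
HB.instance Definition _ x := GRing.Linear.copy (lact x)
  (lext (fun u : G * G => gb u.1 * x * gb u.2^-1)).

Definition ract (x : galg F G) : galg F (G * G)%type -> galg F G :=
  lext (fun u : G * G => gb u.1^-1 * x * gb u.2).
HB.instance Definition _ x := GRing.Linear.copy (ract x)
  (lext (fun u : G * G => gb u.1^-1 * x * gb u.2)).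

Lemma lact_lin I (r : seq I) (a : I -> F) (f : I -> galg F G) M :
  lact (\sum_(i <- r) a i *: f i) M = \sum_(i <- r) a i *: lact (f i) M.
Proof.
rewrite /lact /lext; under [RHS]eq_bigr do rewrite scaler_sumr.
rewrite exchange_big; apply: eq_bigr => u _; rewrite mulr_sumr mulr_suml scaler_sumr.
by apply: eq_bigr => i _; rewrite -scalerAr -scalerAl !scalerA mulrC.
Qed.

Lemma ract_lin I (r : seq I) (a : I -> F) (f : I -> galg F G) M :
  ract (\sum_(i <- r) a i *: f i) M = \sum_(i <- r) a i *: ract (f i) M.
Proof.
rewrite /ract /lext; under [RHS]eq_bigr do rewrite scaler_sumr.
rewrite exchange_big; apply: eq_bigr => u _; rewrite mulr_sumr mulr_suml scaler_sumr.
by apply: eq_bigr => i _; rewrite -scalerAr -scalerAl !scalerA mulrC.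
Qed.

Lemma lactZ a x M : lact (a *: x) M = a *: lact x M.
Proof. by have := lact_lin [:: tt] (fun _ => a) (fun _ => x) M; rewrite !big_seq1. Qed.

Lemma ractZ a x M : ract (a *: x) M = a *: ract x M.
Proof. by have := ract_lin [:: tt] (fun _ => a) (fun _ => x) M; rewrite !big_seq1. Qed.

Lemma lact_gb u x : lact x (gb u) = gb u.1 * x * gb u.2^-1.
Proof. exact: lext_gb. Qed.
Lemma ract_gb u x : ract x (gb u) = gb u.1^-1 * x * gb u.2.
Proof. exact: lext_gb. Qed.

Lemma lactM M N x : lact x (M * N) = lact (lact x N) M.
Proof.
rewrite (gb_sum N) mulr_sumr !linear_sum /=.
under [in RHS]eq_bigr do rewrite linearZ /=.
rewrite lact_lin; apply: eq_bigr => v _; rewrite -scalerAr linearZ /=; congr (_ *: _).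
rewrite (gb_sum M) mulr_suml !linear_sum /=; apply: eq_bigr => u _.
rewrite -scalerAl !linearZ /=; congr (_ *: _).
by rewrite -gbM !lact_gb /= invMg !gbM !mulrA.
Qed.

Lemma ractM M N x : ract x (M * N) = ract (ract x M) N.
Proof.
rewrite (gb_sum M) mulr_suml !linear_sum /=.
under [in RHS]eq_bigr do rewrite linearZ /=.
rewrite ract_lin; apply: eq_bigr => u _; rewrite -scalerAl linearZ /=; congr (_ *: _).
rewrite (gb_sum N) mulr_sumr !linear_sum /=; apply: eq_bigr => v _.
rewrite -scalerAr !linearZ /=; congr (_ *: _).
by rewrite -gbM !ract_gb /= invMg !gbM !mulrA.
Qed.

Lemma gb_pairXX (x y : G) i a :
  gb ((x, 1%g) : (G * G)%type) ^+ i * gb (1%g, y) ^+ a = gb ((x ^+ i)%g, (y ^+ a)%g).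
Proof.
by rewrite -!gbX pairX1 pair1X -gbM; congr gb; congr (_, _); rewrite /= ?mulg1 ?mul1g.
Qed.

(** For g a power of x and h a power of y, the term g u h^-1 equals g h^-1 u, since u commutes with
    y. *)
Lemma lact_bichar x y u : GRing.comm u (gb y) ->
  lact u (R (gb (x, 1%g)) (gb (1%g, y))) = R (gb x) (gb y^-1) * u.
Proof.
move=> uy; rewrite !bicharE -scalerAl mulr_suml linearZ /=; congr (_ *: _).
rewrite linear_sum /=; apply: eq_bigr => i _.
rewrite mulr_suml linear_sum /=; apply: eq_bigr => a _.
rewrite -scalerAl linearZ /= gb_pairXX lact_gb /= -mulrA; congr (_ *: _).
rewrite -!gbX -mulrA expgVn; congr (_ * _).
have e : u * gb (y ^+ a) = gb (y ^+ a) * u by rewrite gbX; apply: commrX.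
by rewrite -[u in LHS]mul1r -[X in X * u](gbVl F (y ^+ a)%g) -!mulrA (mulrA (gb (y ^+ a))) -e
  -!mulrA gbV mulr1.
Qed.

Lemma ract_bichar x y u : GRing.comm u (gb y) ->
  ract u (R (gb (x, 1%g)) (gb (1%g, y))) = R (gb x^-1) (gb y) * u.
Proof.
move=> uy; rewrite !bicharE -scalerAl mulr_suml linearZ /=; congr (_ *: _).
rewrite linear_sum /=; apply: eq_bigr => i _.
rewrite mulr_suml linear_sum /=; apply: eq_bigr => a _.
rewrite -scalerAl linearZ /= gb_pairXX ract_gb /= -!mulrA; congr (_ *: _).
by rewrite -!gbX expgVn; congr (_ * _); rewrite gbX; apply: commrX.
Qed.

Lemma comm_twP : GRing.comm P (gb s2).
Proof. by apply/commr_sym/comm_bichar => //; apply/gb_comm. Qed.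
Lemma comm_twQ : GRing.comm Q (gb s2^-1).
Proof. by apply/commr_sym/comm_bichar => //; apply/commr_sym/gb_comm/commuteV. Qed.

Lemma lact_dg x : lact 1 (dg x) = (geps x)%:A.
Proof.
have -> : dg x = \sum_g x g *: gb (g, g) by [].
rewrite /geps linear_sum scaler_suml.
by apply: eq_bigr => g _; rewrite linearZ /= lact_gb /= mulr1 gbV.
Qed.

Lemma ract_dg x : ract 1 (dg x) = (geps x)%:A.
Proof.
have -> : dg x = \sum_g x g *: gb (g, g) by [].
rewrite /geps linear_sum scaler_suml.
by apply: eq_bigr => g _; rewrite linearZ /= ract_gb /= mulr1 gbVl.
Qed.

Lemma ginv_gb (g : G) : ginv (gb g) = gb g^-1. Proof. exact: lext_gb. Qed.

Lemma ginvM (x y : galg F G) : ginv (x * y) = ginv y * ginv x.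
Proof.
rewrite (gb_sum x) mulr_suml !linear_sum mulr_sumr; apply: eq_bigr => g _.
rewrite (gb_sum y) mulr_sumr !linear_sum mulr_suml; apply: eq_bigr => h _.
rewrite -scalerAr -!scalerAl -gbM !linearZ /= !ginv_gb invMg gbM.
by rewrite -scalerAl -scalerAr.
Qed.

(** In the action of J (dg x) K on Q, first K sends Q to P Q = 1, then dg x multiplies 1 by eps(x),
    then J sends 1 to Q; the remaining factor P cancels Q. *)
Lemma antipode_r x : \sum_g \sum_h D x (g, h) *: (gb g * S (gb h)) = (geps x)%:A.
Proof.
transitivity (lact Q (D x) * P).
  rewrite /lact /lext mulr_suml pair_bigA; apply: eq_bigr => -[g h] _ /=.
  by rewrite -scalerAl /twS ginv_gb !mulrA.
rewrite /twD !lactM [lact Q _]lact_bichar ?invgK; last exact: comm_twQ.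
rewrite twPQ lact_dg lactZ lact_bichar; last exact/commr_sym/commr1.
by rewrite mulr1 -scalerAl twQP.
Qed.

(** The mirror image: from the right, J sends P to Q P = 1, dg x contributes eps(x), and K sends 1
    to P. *)
Lemma antipode_l x : \sum_g \sum_h D x (g, h) *: (S (gb g) * gb h) = (geps x)%:A.
Proof.
transitivity (Q * ract P (D x)).
  rewrite /ract /lext mulr_sumr pair_bigA; apply: eq_bigr => -[g h] _ /=.
  by rewrite -scalerAr /twS ginv_gb !mulrA.
rewrite /twD !ractM [ract P _]ract_bichar; last exact: comm_twP.
rewrite bicharVV // twQP ract_dg ractZ ract_bichar; last exact/commr_sym/commr1.
rewrite mulr1 bicharVV ?invgK ?expgVn ?s2q ?invg1 //; last exact: commuteV.
by rewrite -scalerAr twQP.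
Qed.

Lemma ginv_bichar (x y : G) : commute x y -> ginv (R (gb x) (gb y)) = R (gb x^-1) (gb y^-1).
Proof.
move=> xy; rewrite !bicharE linearZ /=; congr (_ *: _); rewrite linear_sum; apply: eq_bigr => i _.
rewrite linear_sum; apply: eq_bigr => a _; rewrite linearZ /=; congr (_ *: _).
rewrite -!gbX -!gbM ginv_gb invMg !expgVn; congr gb.
by rewrite -!expgVn; apply/commuteX2/commute_sym/commuteV/commute_sym/commuteV.
Qed.

Lemma ginvK (x : galg F G) : ginv (ginv x) = x.
Proof.
by apply: (@lin_ext _ _ _ (@ginv F G \o @ginv F G) idfun) => g; rewrite /= !ginv_gb invgK.
Qed.

(** [ginv] fixes both P and Q, so S(S x) = Q P x Q P = x. *)
Lemma twSK x : S (S x) = x.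
Proof.
rewrite /twS !ginvM ginvK !ginv_bichar ?invgK; [|exact: commuteV|by []].
rewrite !bicharVV ?invgK ?expgVn ?s2q ?invg1 //; last exact: commuteV.
by rewrite !mulrA twQP mul1r -mulrA twQP mulr1.
Qed.

Lemma geps_bichar (x y : G) : commute x y -> geps (R (gb x) (gb y)) = 1.
Proof.
move=> xy.
(* The constant morphism g |-> 1 extends linearly to u |-> eps(u) 1, and it maps R(x, y) to R(1, 1)
   = 1. *)
have e (u : galg F G) : gmap (fun _ : G => 1%g : G) u = (geps u)%:A.
  rewrite {1}/gmap /lext /geps scaler_suml; exact: eq_bigr.
have := e (R (gb x) (gb y)); rewrite gmap_bichar => [|g h]; last by rewrite mulg1.
by rewrite (bichar1 zq) // => /ffunP/(_ 1%g); rewrite gscaleE gbE eqxx mulr1 => <-.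
Qed.

Lemma geps_ginv (x : galg F G) : geps (ginv x) = geps x.
Proof.
have -> : ginv x = \sum_g x g *: gb g^-1 by [].
rewrite linear_sum; apply: eq_bigr => g _.
by rewrite linearZ /= geps_gb mulr1.
Qed.

Lemma geps_twS x : geps (S x) = geps x.
Proof.
rewrite !gepsM geps_ginv !geps_bichar ?mul1r ?mulr1 //; exact: commuteV.
Qed.

End TwistTheory.

(** * Coassociativity *)

Section Coassoc.
Variables (F : fieldType) (q : nat) (z : F).
Hypotheses (zq : q.-primitive_root z) (qF : q%:R != 0 :> F).
Local Notation R := (bichar q z).
Local Notation gb := (gb F).

Lemma bichar_coef (G : finGroupType) (x y w : G) : R (gb x) (gb y) w =
  q%:R^-1 * \sum_(i < q) \sum_(a < q) z ^+ (i * a) * (w == (x ^+ i * y ^+ a)%g)%:R.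
Proof.
rewrite bicharE gscaleE gsumE; congr (_ * _); apply: eq_bigr => i _.
by rewrite gsumE; apply: eq_bigr => a _; rewrite gscaleE -!gbX -gbM gbE.
Qed.

Lemma bichar_supp (G : finGroupType) (x y w : G) : R (gb x) (gb y) w != 0 ->
  exists i a, w = (x ^+ i * y ^+ a)%g.
Proof.
rewrite bichar_coef => nz.
suff /existsP[i /existsP[a /eqP e]] : [exists i : 'I_q, exists a : 'I_q, w == (x ^+ i * y ^+ a)%g].
  by exists i, a.
apply: contraR nz => /existsPn nz; apply/eqP; rewrite big1 ?mulr0 // => i _.
rewrite big1 // => a _; have /existsPn/(_ a)/negPf-> := nz i; exact: mulr0.
Qed.

Variables (G : finGroupType) (s1 s2 : G).
Hypotheses (s1q : (s1 ^+ q = 1)%g) (s2q : (s2 ^+ q = 1)%g) (s12 : commute s1 s2).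
Local Notation J := (twJ q z s1 s2).
Local Notation K := (twK q z s1 s2).
Local Notation D := (twD q z s1 s2).
Local Notation S := (twS q z s1 s2).

(** Here g (x) g commutes with J, so the twist cancels and g remains grouplike. *)
Lemma twD_gb_comm g : commute g s1 -> commute g s2 -> D (gb g) = gb (g, g).
Proof.
move=> g1 g2; rewrite /twD dg_gb.
have -> : J * gb (g, g) = gb (g, g) * J.
  by apply/esym/comm_bichar; apply/gb_comm/pair_comm => //; exact: commute1.
by rewrite -mulrA (twJK zq qF _ s1q) // mulr1.
Qed.

Lemma gb_row1 (g k : G) : gb (g, g) (1%g, k) = gb g 1%g * (k == 1%g)%:R.
Proof.
rewrite !gbE -natrM mulnb xpair_eqE; case: (eqVneq 1%g g) => [<-|_] //=.
Qed.

(** This says lam(x_1) x_2 = lam(x) 1: lam is an integral of the dual of H. Elements of <s_1> stay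
    grouplike; for g outside <s_1>, the first leg of D g is supported in <s_1> g <s_1>, which misses
    1. *)
Lemma twD_row1 x k : D x (1%g, k) = x 1%g * (k == 1%g)%:R.
Proof.
rewrite {1}(gb_sum x) linear_sum gsumE {2}(gb_sum x) gsumE mulr_suml.
apply: eq_bigr => g _; rewrite linearZ /= !gscaleE -mulrA; congr (_ * _).
have [/cycleP[n ->]|gn] := boolP (g \in <[s1]>%g).
  rewrite twD_gb_comm ?gb_row1 //; first exact/commute_sym/commuteX.
  exact/commute_sym/commuteX/commute_sym.
rewrite [X in _ = X * _]gbE (negPf (_ : 1%g != g)) ?mul0r; last first.
  by apply: contraNneq gn => <-; apply: group1.
apply: contraNeq gn => /gmul_supp[u [v [/gmul_supp[w [w' [/bichar_supp[i [a ->]]]]]]]].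
rewrite dg_gb gbE; case: (w' =P (g, g)) => [-> _|_]; last by rewrite eqxx.
move=> -> /bichar_supp[j [b ->]].
rewrite !pairX1 !pair1X => -[+ _]; rewrite /= !mulg1 => e.
have -> : g = (s1 ^- i * s1 ^- j)%g.
  by rewrite -[(s1 ^- j)%g]mul1g e mulgK mulKg.
by rewrite groupM ?groupV ?mem_cycle.
Qed.

Lemma bichar_cocycle_gb (H : finGroupType) (x1 x2 y2 y3 : H) :
  (x1 ^+ q = 1)%g -> (y3 ^+ q = 1)%g -> commute x1 x2 -> commute x1 y2 ->
  commute x1 y3 -> commute x2 y2 -> commute x2 y3 -> commute y2 y3 ->
  R (gb x1) (gb y2) * R (gb (x1 * x2)%g) (gb y3) = R (gb x2) (gb y3) * R (gb x1) (gb (y2 * y3)%g) /\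
  R (gb (x1 * x2)%g) (gb y3) * R (gb x1) (gb y2) = R (gb x1) (gb (y2 * y3)%g) * R (gb x2) (gb y3).
Proof.
move=> *; rewrite !gbM; split.
  by apply: (bichar_cocycle zq); rewrite ?gb_expq //; exact: gb_comm.
by apply: (bichar_cocycle_rev zq); rewrite ?gb_expq //; exact: gb_comm.
Qed.

Local Notation G3 := ((G * G) * G)%type.

(** [D12] and [D23] apply the twisted comultiplication to the left and to the right leg ([D12E],
    [D23E]). Written multiplicatively, they reduce coassociativity to identities between
    bicharacters. *)
Definition D12 (M : galg F (G * G)%type) : galg F G3 :=
  tn J 1 * gmap (fun u : G * G => ((u.1, u.1), u.2)) M * tn K 1.

Definition assoc3 (u : G * (G * G)) : G3 := ((u.1, u.2.1), u.2.2).

Definition D23 (M : galg F (G * G)%type) : galg F G3 :=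
  gmap assoc3 (tn 1 J * gmap (fun u : G * G => (u.1, (u.2, u.2))) M * tn 1 K).

Lemma D12E M : D12 M = \sum_a \sum_b M (a, b) *: tn (D (gb a)) (gb b).
Proof.
have -> : D12 M = tn J 1 * (\sum_u M u *: gb ((u.1, u.1), u.2)) * tn K 1 by [].
rewrite mulr_sumr mulr_suml pair_bigA; apply: eq_bigr => -[a b] _ /=.
rewrite -scalerAr -scalerAl; congr (_ *: _).
by rewrite -tn_gb -!tnM mulr1 mul1r /twD dg_gb.
Qed.

Lemma D23E M : D23 M = gmap assoc3 (\sum_a \sum_b M (a, b) *: tn (gb a) (D (gb b))).
Proof.
congr gmap.
have -> : gmap (fun u : G * G => (u.1, (u.2, u.2))) M = \sum_u M u *: gb (u.1, (u.2, u.2)) by [].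
rewrite mulr_sumr mulr_suml pair_bigA; apply: eq_bigr => -[a b] _ /=.
rewrite -scalerAr -scalerAl; congr (_ *: _).
by rewrite -tn_gb -!tnM mulr1 mul1r /twD dg_gb.
Qed.

Lemma D12_coef M c d e : D12 M ((c, d), e) = \sum_a M (a, e) * D (gb a) (c, d).
Proof.
rewrite D12E gsumE; apply: eq_bigr => a _; rewrite gsumE (bigD1 e) //= big1 => [|b be].
  by rewrite addr0 gscaleE tnE gbE eqxx mulr1.
by rewrite gscaleE tnE gbE eq_sym (negPf be) !mulr0.
Qed.

Lemma assoc3_coef (M : galg F (G * (G * G))%type) c d e : gmap assoc3 M ((c, d), e) = M (c, (d, e)).
Proof.
have -> : gmap assoc3 M = \sum_u M u *: gb (assoc3 u) by [].
rewrite gsumE (bigD1 (c, (d, e))) //= big1 => [|[c' [d' e']] ne].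
  by rewrite addr0 gscaleE gbE eqxx mulr1.
rewrite gscaleE gbE /assoc3 /=; case: eqP => [[cc dd ee]|]; last by rewrite mulr0.
by case/eqP: ne; rewrite cc dd ee.
Qed.

Lemma D23_coef M c d e : D23 M ((c, d), e) = \sum_b M (c, b) * D (gb b) (d, e).
Proof.
rewrite D23E assoc3_coef gsumE (bigD1 c) //= [X in _ + X]big1 => [|a ac].
  rewrite addr0 gsumE; apply: eq_bigr => b _.
  by rewrite gscaleE tnE gbE eqxx mul1r.
by rewrite gsumE big1 // => b _; rewrite gscaleE tnE gbE eq_sym (negPf ac) mul0r mulr0.
Qed.

Lemma tn_bicharl (x y : (G * G)%type) :
  tn (R (gb x) (gb y)) (1 : galg F G) = R (gb (x, 1%g)) (gb (y, 1%g)).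
Proof.
rewrite -(@gmap_bichar F _ _ (fun u : G * G => (u, 1%g : G))) => [|u v]; last first.
  by congr (_, _); rewrite mulg1.
apply: (@lin_ext _ _ _ (tnr (1 : galg F G)) (gmap (fun u : G * G => (u, 1%g : G)))) => g.
by rewrite /= /tnr gmap_gb -tn_gb.
Qed.

Lemma tn_bicharr (x y : (G * G)%type) :
  tn (1 : galg F G) (R (gb x) (gb y)) = R (gb (1%g, x)) (gb (1%g, y)).
Proof.
rewrite -(@gmap_bichar F _ _ (fun u : G * G => (1%g : G, u))) => [|u v]; last first.
  by congr (_, _); rewrite mulg1.
apply: (@lin_ext _ _ _ (tn (1 : galg F G)) (gmap (fun u : G * G => (1%g : G, u)))) => g.
by rewrite /= gmap_gb -tn_gb.
Qed.

Lemma twD_coassoc x : D12 (D x) = D23 (D x).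
Proof.
have a3M : {morph assoc3 : g h / (g * h)%g} by [].
rewrite /D12 /D23 /twD /dg !gmapM // !mulrA !gmap_comp /=.
rewrite /twJ /twK !gmap_bichar //= !tn_bicharl !tn_bicharr !gmap_bichar //= /assoc3 /=.
(* The letters x carry s_1 and the letters y the other argument; the index is the tensor leg. In
   this notation the two sides differ by the cocycle identity for J on the left and the one for its
   inverse on the right. *)
pose x1 : G3 := ((s1, 1%g), 1%g); pose x2 : G3 := ((1%g, s1), 1%g).
pose y2 (h : G) : G3 := ((1%g, h), 1%g); pose y3 (h : G) : G3 := ((1%g, 1%g), h).
have e1 : ((s1, s1), 1%g) = (x1 * x2)%g by congr ((_, _), _); rewrite /= ?mul1g ?mulg1.
have e2 h : ((1%g, h), h) = (y2 h * y3 h)%g by congr ((_, _), _); rewrite /= ?mul1g ?mulg1.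
have x1q : (x1 ^+ q = 1)%g.
  by rewrite /x1 !pairX1 s1q.
have y3q h : (h ^+ q = 1)%g -> (y3 h ^+ q = 1)%g.
  by move=> hq; rewrite /y3 pair1X hq.
have cc h : commute s1 h -> (h ^+ q = 1)%g ->
  R (gb x1) (gb (y2 h)) * R (gb (x1 * x2)%g) (gb (y3 h))
    = R (gb x2) (gb (y3 h)) * R (gb x1) (gb (y2 h * y3 h)%g) /\
  R (gb (x1 * x2)%g) (gb (y3 h)) * R (gb x1) (gb (y2 h))
   = R (gb x1) (gb (y2 h * y3 h)%g) * R (gb x2) (gb (y3 h)).
  move=> s1h hq; apply: bichar_cocycle_gb; rewrite ?y3q //;
    by do ![apply: pair_comm => //]; first [exact: commute1 | exact/commute_sym/commute1].
have [c1 _] := cc s2 s12 s2q.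
have s2Vq : (s2^-1 ^+ q = 1)%g by rewrite expgVn s2q invg1.
have [_ c2] := cc _ (commuteV s12) s2Vq.
rewrite e1 !e2 -!mulrA [LHS]mulrA [RHS]mulrA; congr (_ * _); first exact: c1.
by congr (_ * _); exact: c2.
Qed.

Lemma twD_coassoc_coef x c d e :
  \sum_a D x (a, e) * D (gb a) (c, d) = \sum_b D x (c, b) * D (gb b) (d, e).
Proof. by rewrite -D12_coef -D23_coef twD_coassoc. Qed.

(* a_1 (x) a_2 S(a_3) = a (x) 1 *)
Lemma twD_antipode_r x :
  \sum_h \sum_k D x (h, k) *: (D (gb h) * tn 1 (S (gb k))) = tn x 1.
Proof.
transitivity (\sum_h \sum_k \sum_c \sum_d
    (D x (h, k) * D (gb h) (c, d)) *: tn (gb c) (gb d * S (gb k))).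
  apply: eq_bigr => h _; apply: eq_bigr => k _.
  rewrite {1}(tn_sum (D (gb h))) mulr_suml scaler_sumr; apply: eq_bigr => c _.
  rewrite mulr_suml scaler_sumr; apply: eq_bigr => d _.
  by rewrite -scalerAl scalerA -tnM mulr1.
transitivity (\sum_k \sum_c \sum_d
    (\sum_h D x (h, k) * D (gb h) (c, d)) *: tn (gb c) (gb d * S (gb k))).
  rewrite exchange_big; apply: eq_bigr => k _.
  rewrite exchange_big; apply: eq_bigr => c _.
  by rewrite exchange_big; apply: eq_bigr => d _; rewrite scaler_suml.
(* Coassociativity moves the second splitting to the right leg, where the antipode axiom applies. *)
transitivity (\sum_c \sum_b D x (c, b) *:
    tn (gb c) (\sum_d \sum_k D (gb b) (d, k) *: (gb d * S (gb k)))).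
  rewrite exchange_big; apply: eq_bigr => c _.
  under eq_bigr => k _ do under eq_bigr => d _ do
    rewrite twD_coassoc_coef scaler_suml.
  under [LHS]eq_bigr do rewrite exchange_big.
  rewrite exchange_big; apply: eq_bigr => b _.
  rewrite exchange_big linear_sum scaler_sumr; apply: eq_bigr => d _.
  rewrite linear_sum scaler_sumr; apply: eq_bigr => k _.
  by rewrite linearZ scalerA.
rewrite {2}(gb_sum x) -[RHS]/(tnr 1 _) linear_sum; apply: eq_bigr => c _.
rewrite linearZ /= -(twD_fst zq qF s1 s2) scaler_suml; apply: eq_bigr => b _.
by rewrite antipode_r // geps_gb scale1r.
Qed.

End Coassoc.

(** * Integrals of Hopf subalgebras *)

(** Write A = C R with C of full column rank and R of full row rank. Then C R C R = 0 gives R C = 0,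
    and tr(C R) = tr(R C). *)
Lemma mxtrace_sqr0 (F : fieldType) n (A : 'M[F]_n) : A *m A = 0 -> \tr A = 0.
Proof.
move=> AA; have rc : row_base A *m col_base A = 0.
  apply: (row_full_inj (col_base_full A)); rewrite mulmx0.
  apply: (row_free_inj (row_base_free A)); rewrite mul0mx.
  by rewrite mulmxA mulmx_base -mulmxA mulmx_base.
by rewrite -(mulmx_base A) mxtrace_mulC rc mxtrace0.
Qed.

Section Span.
Variables (F : fieldType) (G : finGroupType).
Local Notation gb := (gb F).
Implicit Types x y a : galg F G.

Lemma trace_sqr0 (T : {linear galg F G -> galg F G}) :
  (forall y, T (T y) = 0) -> \sum_g T (gb g) g = 0.
Proof.
move=> TT; pose A : 'M[F]_#|G| := \matrix_(i, j) T (gb (enum_val i)) (enum_val j).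
have <- : \tr A = \sum_g T (gb g) g.
  rewrite (reindex (@enum_val G G)); last exact/onW_bij/enum_val_bij.
  by apply: eq_bigr => i _; rewrite mxE.
apply: mxtrace_sqr0; apply/matrixP=> i j; rewrite !mxE.
have /ffunP/(_ (enum_val j)) := TT (gb (enum_val i)).
rewrite {1}(gb_sum (T (gb (enum_val i)))) linear_sum gsumE ffunE => e; rewrite -[RHS]e.
rewrite [RHS](reindex (@enum_val G G)); last exact/onW_bij/enum_val_bij.
apply: eq_bigr => k _; by rewrite !mxE linearZ gscaleE.
Qed.

Lemma gmul1E x y : (x * y) 1%g = \sum_h x h * y h^-1%g.
Proof. by rewrite gmulE; apply: eq_bigr => h _; rewrite mulg1. Qed.

Variables (m : nat) (b : 'I_m -> galg F G).
(** A subspace is given by a spanning family, possibly dependent, to match the row space of a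
    matrix. *)
Definition lspan x := exists c : 'I_m -> F, x = \sum_i c i *: b i.

Lemma lspan_sum I (r : seq I) (P : pred I) (c : I -> F) (f : I -> galg F G) :
  (forall i, P i -> lspan (f i)) -> lspan (\sum_(i <- r | P i) c i *: f i).
Proof.
move=> sf; apply: big_ind => [|x y [c1 ->] [c2 ->]|i Pi].
- by exists (fun _ => 0); rewrite big1 // => i _; rewrite scale0r.
- exists (fun i => c1 i + c2 i); rewrite -big_split; apply: eq_bigr => i _.
  by rewrite scalerDl.
have [d ->] := sf i Pi; exists (fun j => c i * d j); rewrite scaler_sumr.
by apply: eq_bigr => j _; rewrite scalerA.
Qed.

Lemma lspan_b i : lspan (b i).
Proof.
exists (fun j => (j == i)%:R); rewrite (bigD1 i) //= big1 => [|j /negPf ji].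
  by rewrite /= addr0 eqxx scale1r.
by rewrite ji scale0r.
Qed.

Lemma lspanZ c x : lspan x -> lspan (c *: x).
Proof. by case=> d ->; rewrite scaler_sumr; under eq_bigr do rewrite scalerA;
  apply: lspan_sum => i _; apply: lspan_b. Qed.

Lemma lspanD x y : lspan x -> lspan y -> lspan (x + y).
Proof.
move=> [c ->] [d ->]; rewrite -big_split /=; under eq_bigr do rewrite -scalerDl.
by apply: lspan_sum => i _; apply: lspan_b.
Qed.

(** The Fredholm alternative for the Gram matrix of the trace form on the span: prescribed values f
    are attained by some e as soon as f vanishes on the combinations lying in the radical. *)
Lemma lspan_dual (f : 'I_m -> F) :
  (forall c : 'I_m -> F, (forall x, lspan x -> (x * (\sum_j c j *: b j)) 1%g = 0) ->
     \sum_j c j * f j = 0) ->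
  exists2 e, lspan e & forall j, (e * b j) 1%g = f j.
Proof.
move=> H; pose A : 'M[F]_m := \matrix_(i, j) (b i * b j) 1%g.
have /submxP[c ec] : (\row_j f j <= A)%MS.
  rewrite submxE; apply/eqP/matrixP=> i k; rewrite mxE [RHS]mxE.
  under eq_bigr => j _ do rewrite mxE mulrC.
  apply: H => x [d ->]; rewrite mulr_suml gsumE big1 // => l _.
  rewrite -scalerAl gscaleE mulr_sumr gsumE; apply/eqP; rewrite mulf_eq0; apply/orP; right.
  apply/eqP; have /matrixP/(_ l k) := mulmx_coker A.
  rewrite mxE [RHS]mxE => AK; rewrite -[RHS]AK; apply: eq_bigr => j _.
  by rewrite -scalerAr gscaleE !mxE mulrC.
exists (\sum_i c 0 i *: b i); first by exists (c 0).
move=> j; have /matrixP/(_ 0 j) := ec; rewrite !mxE => ->.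
rewrite mulr_suml gsumE; apply: eq_bigr => i _.
by rewrite -scalerAl gscaleE !mxE.
Qed.

End Span.

Section HopfSub.
Variables (F : fieldType) (q : nat) (z : F).
Hypotheses (zq : q.-primitive_root z) (qF : q%:R != 0 :> F).
Local Notation gb := (gb F).
Variables (G : finGroupType) (s1 s2 : G).
Hypotheses (s1q : (s1 ^+ q = 1)%g) (s2q : (s2 ^+ q = 1)%g) (s12 : commute s1 s2).
Hypothesis G0 : #|G|%:R != 0 :> F.
Local Notation J := (twJ q z s1 s2).
Local Notation K := (twK q z s1 s2).
Local Notation D := (twD q z s1 s2).
Local Notation S := (twS q z s1 s2).
Implicit Types x y a : galg F G.

(** Left multiplication by x has trace |G| x(1) in the group basis, and here its square is zero. *)
Lemma sqr0_coef1 x : x * x = 0 -> x 1%g = 0.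
Proof.
move=> xx; apply: (mulfI G0); rewrite mulr0.
pose T := lext (fun g => x * gb g).
have TE y : T y = x * y.
  rewrite {2}(gb_sum y) mulr_sumr; apply: eq_bigr => g _; exact: scalerAr.
rewrite -[RHS](@trace_sqr0 F G T) => [|y]; last first.
  by rewrite -[LHS]/(T (T y)) !TE mulrA xx mul0r.
rewrite -sumr_const mulr_suml; apply: eq_bigr => g _ /=.
by rewrite -[RHS]/(T (gb g) g) TE mul1r mulgbE mulgV.
Qed.

(** The two families of slices of a tensor, i.e. the rows and columns through which the subcoalgebra
    condition is expressed. *)
Definition rleg (M : galg F (G * G)%type) c : galg F G := [ffun k => M (c, k)].
Definition lleg (M : galg F (G * G)%type) k : galg F G := [ffun c => M (c, k)].

Lemma rlegE M c k : rleg M c k = M (c, k). Proof. by rewrite ffunE. Qed.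
Lemma llegE M c k : lleg M c k = M (k, c). Proof. by rewrite ffunE. Qed.

Lemma rleg_sum I (r : seq I) (P : pred I) (f : I -> galg F (G * G)%type) c :
  rleg (\sum_(i <- r | P i) f i) c = \sum_(i <- r | P i) rleg (f i) c.
Proof. by apply/ffunP=> k; rewrite rlegE !gsumE; apply: eq_bigr => i _; rewrite rlegE. Qed.

Lemma rlegZ c M k : rleg (c *: M) k = c *: rleg M k.
Proof. by apply/ffunP=> h; rewrite rlegE !gscaleE rlegE. Qed.

Lemma row1_tn1r x y : rleg (D x * tn 1 y) 1%g = x 1%g *: y.
Proof.
apply/ffunP=> k; rewrite rlegE gmulE gscaleE.
rewrite (bigD1 (1%g, 1%g)) //= big1 => [|[c d] ne].
  rewrite /= addr0 (twD_row1 zq qF) // eqxx mulr1.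
  rewrite -[((1%g, 1%g)^-1 * _)%g]/((1^-1 * 1)%g, (1^-1 * k)%g) tnE !invg1 !mul1g.
  by rewrite -gb1 gbE eqxx mul1r.
rewrite -[((c, d)^-1 * _)%g]/((c^-1 * 1)%g, (d^-1 * k)%g) tnE -gb1 gbE mulg1 invg_eq1.
case: (c =P 1%g) ne => [->|]; last by rewrite mul0r mulr0.
rewrite (twD_row1 zq qF) // xpair_eqE eqxx /= => /negPf->.
by rewrite mulr0 mul0r.
Qed.

Lemma row1_tn1l M a k : rleg (M * tn a 1) 1%g k = (lleg M k * a) 1%g.
Proof.
rewrite rlegE !gmulE.
transitivity (\sum_c \sum_d M (c, d) * tn a 1 ((c, d)^-1 * (1%g, k))%g).
  by rewrite pair_bigA; apply: eq_bigr => -[c d] _.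
apply: eq_bigr => c _; rewrite (bigD1 k) //= big1 => [|d dk].
  rewrite /= addr0 llegE; congr (_ * _).
  by rewrite -[((c, k)^-1 * _)%g]/((c^-1 * 1)%g, (k^-1 * k)%g) tnE mulVg -gb1 gbE eqxx mulr1.
rewrite -[((c, d)^-1 * _)%g]/((c^-1 * 1)%g, (d^-1 * k)%g) tnE -gb1 gbE.
by rewrite -eq_invg_mul invgK (negPf dk) !mulr0.
Qed.

(* [lamS a x] is lam(x_1 a) x_2 = lam(x a_1) S(a_2), where lam x = x 1. *)
Definition lamS a x : galg F G := rleg (D x * tn a 1) 1%g.

(** Insert a (x) 1 = a_1 (x) a_2 S(a_3) and use D x D(a_1) = D(x a_1); since lam is an integral, the
    slice of D(x a_1) at 1 is lam(x a_1) 1. *)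
Lemma lamSE a x : lamS a x = \sum_k (x * lleg (D a) k) 1%g *: S (gb k).
Proof.
rewrite /lamS -(twD_antipode_r zq qF s1q s2q s12 a) mulr_sumr rleg_sum.
under eq_bigr => h _ do rewrite mulr_sumr rleg_sum.
rewrite exchange_big; apply: eq_bigr => k _; rewrite gmulE scaler_suml.
rewrite (reindex_inj invg_inj) /=; apply: eq_bigr => h _.
rewrite -scalerAr mulrA -(twDM zq qF) // rlegZ row1_tn1r mulgbE scalerA.
by rewrite mul1g invgK mulg1 llegE mulrC.
Qed.

Lemma lamS_col a x k : lamS a x k = (lleg (D x) k * a) 1%g.
Proof. exact: row1_tn1l. Qed.

Lemma lamS_row a x : lamS a x = \sum_c a c^-1%g *: rleg (D x) c.
Proof.
apply/ffunP=> k; rewrite lamS_col gmul1E gsumE; apply: eq_bigr => c _.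
by rewrite llegE gscaleE rlegE mulrC.
Qed.

Lemma S_inj : injective S.
Proof. by apply: can_inj; exact: twSK. Qed.

Variables (m : nat) (b : 'I_m -> galg F G).
Local Notation inB := (lspan b).
Hypotheses (B1 : inB 1) (BM : forall x y, inB x -> inB y -> inB (x * y))
  (BS : forall x, inB x -> inB (S x))
  (Brow : forall x k, inB x -> inB (rleg (D x) k))
  (Bcol : forall x k, inB x -> inB (lleg (D x) k)).

Lemma lamS_in a x : inB x -> inB (lamS a x).
Proof. by move=> Bx; rewrite lamS_row; apply: lspan_sum => c _; exact: Brow. Qed.

Fact lamS_linear a : linear (lamS a).
Proof.
move=> c x y; apply/ffunP=> k; rewrite gaddE gscaleE !lamS_col !gmul1E mulr_sumr -big_split.
by apply: eq_bigr => h _; rewrite !llegE linearP gaddE gscaleE mulrDl mulrA.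
Qed.

HB.instance Definition _ a := GRing.isLinear.Build F _ _ _ (lamS a) (lamS_linear a).

Lemma rleg_gb M h : rleg M h = \sum_k M (h, k) *: gb k.
Proof. by rewrite {1}(gb_sum (rleg M h)); apply: eq_bigr => k _; rewrite rlegE. Qed.

Lemma lleg_gb M k : lleg M k = \sum_h M (h, k) *: gb h.
Proof. by rewrite {1}(gb_sum (lleg M k)); apply: eq_bigr => h _; rewrite llegE. Qed.

(* For a in the radical of the trace form on B, the operator y |-> lam(y a_1) S(a_2)
   maps kG to B and kills B, so it has trace 0; its trace is lam(a_1 S(a_2)) = eps(a). *)
Lemma radical_eps a : inB a -> (forall x, inB x -> (x * a) 1%g = 0) -> geps a = 0.
Proof.
move=> Ba Na.
have T0 x : inB x -> lamS a x = 0.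
  by move=> Bx; apply/ffunP=> k; rewrite lamS_col Na ?ffunE //; exact: Bcol.
have TB y : inB (lamS a y).
  have -> : lamS a y = \sum_h y h^-1%g *: S (rleg (D a) h).
    rewrite lamSE; under [RHS]eq_bigr do rewrite rleg_gb linear_sum scaler_sumr.
    rewrite exchange_big; apply: eq_bigr => k _; rewrite gmul1E scaler_suml.
    rewrite (reindex_inj invg_inj) /=; apply: eq_bigr => h _.
    by rewrite linearZ /= invgK llegE scalerA.
  by apply: lspan_sum => h _; apply/BS/Brow.
have := trace_sqr0 (T := lamS a) (fun y => T0 _ (TB y)).
have <- : ((geps a)%:A : galg F G) 1%g = geps a by rewrite gscaleE -gb1 gbE eqxx mulr1.
rewrite -(antipode_r zq qF s1q s12) => <-.
rewrite gsumE.
under eq_bigr => g _ do rewrite gsumE.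
under [RHS]eq_bigr => g _ do rewrite /= lamSE gsumE.
rewrite exchange_big [RHS]exchange_big; apply: eq_bigr => k _.
rewrite (reindex_inj invg_inj); apply: eq_bigr => g _ /=.
by rewrite !gscaleE !gbmulE mulg1 llegE mulg1 invgK.
Qed.

(** By [lamSE] and the injectivity of S, the left slices of D a lie in the radical together with a.
    Their counits vanish by [radical_eps], and these are the coefficients of a. *)
Lemma radical0 a : inB a -> (forall x, inB x -> (x * a) 1%g = 0) -> a = 0.
Proof.
move=> Ba Na; apply/ffunP=> k; rewrite ffunE -(twD_snd zq qF s1 s2 a k).
have <- : geps (lleg (D a) k) = \sum_h D a (h, k).
  by apply: eq_bigr => h _; rewrite llegE.
apply: radical_eps => [|x Bx]; first exact: Bcol.
have : \sum_k (x * lleg (D a) k) 1%g *: gb k = 0.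
  apply: S_inj; rewrite linear0 linear_sum /=.
  under eq_bigr do rewrite linearZ /=.
  rewrite -lamSE; apply/ffunP=> h; rewrite lamS_col Na ?ffunE //; exact: Bcol.
move/ffunP/(_ k); rewrite [X in _ = X]ffunE gsumE (bigD1 k) //= big1 => [|h /negPf hk].
  by rewrite /= addr0 gscaleE gbE eqxx mulr1.
by rewrite gscaleE gbE eq_sym hk mulr0.
Qed.

(** As eps vanishes on the radical, some e in B satisfies lam(e x) = eps(x) on B. Then e x - eps(x)
    e and x e - eps(x) e lie in the radical, hence vanish; it remains to normalise e. *)
Lemma exists_integral : exists e, [/\ inB e, geps e = 1,
  forall x, inB x -> e * x = geps x *: e & forall x, inB x -> x * e = geps x *: e].
Proof.
have [|e Be ebj] := @lspan_dual F G m b (fun j => geps (b j)).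
  move=> c Hc; rewrite -[RHS](@radical_eps (\sum_j c j *: b j)) //; last by exists c.
  by rewrite linear_sum; apply: eq_bigr => j _; rewrite linearZ.
have ex x : inB x -> (e * x) 1%g = geps x.
  case=> c ->; rewrite mulr_sumr gsumE linear_sum; apply: eq_bigr => j _.
  by rewrite -scalerAr gscaleE ebj linearZ.
have eZ x : inB x -> e * x = geps x *: e.
  move=> Bx; apply/eqP; rewrite -subr_eq0; apply/eqP; apply: radical0 => [|y By].
    by rewrite -scaleN1r; apply: lspanD; [exact: BM | do 2 apply: lspanZ].
  rewrite gmul_tr mulrBl gaddE -mulrA ex; last exact: BM.
  by rewrite -scalerAl -scaleNr gscaleE ex // gepsM mulNr subrr.
have Ze x : inB x -> x * e = geps x *: e.
  move=> Bx; apply/eqP; rewrite -subr_eq0; apply/eqP; apply: radical0 => [|y By].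
    by rewrite -scaleN1r; apply: lspanD; [exact: BM | do 2 apply: lspanZ].
  rewrite gmul_tr mulrBl gaddE -mulrA eZ // -scalerAr -scalerAl -scaleNr !gscaleE.
  by rewrite gmul_tr !ex // mulNr mulrC subrr.
(* If eps(e) = 0 then e e = 0, hence lam(e) = 0 by [sqr0_coef1]; but lam(e) = eps(1) = 1. *)
have e0 : geps e != 0.
  apply/eqP => e0; have := @sqr0_coef1 e; rewrite eZ // e0 scale0r => /(_ erefl).
  by have := ex 1 B1; rewrite mulr1 geps1 => -> /eqP; rewrite oner_eq0.
exists ((geps e)^-1 *: e); split; first exact: lspanZ.
- by rewrite linearZ /= mulVf.
- by move=> x Bx; rewrite -scalerAl eZ // !scalerA mulrC.
by move=> x Bx; rewrite -scalerAr Ze // !scalerA mulrC.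
Qed.

End HopfSub.

(** * Coinvariants *)

(** The element s^(c - a) generates <s>, because c - a is nonzero modulo the prime q. *)
Lemma expg_prime_mem (G : finGroupType) (N : {group G}) q (s : G) a c :
  prime q -> (s ^+ q = 1)%g -> (a < q)%N -> (c < q)%N -> a != c ->
  (s ^- a * s ^+ c \in N)%g -> s \in N.
Proof.
move=> q_pr sq aq cq ac; have -> : (s ^- a = s ^+ (q - a))%g.
  by apply: (mulIg (s ^+ a)%g); rewrite mulVg -expgD subnK ?sq // ltnW.
rewrite -expgD; set k := (_ + _)%N => skN.
have qk : coprime q k.
  rewrite prime_coprime //; apply: contra ac => /eqP k0.
  have e : (a + k = c + q)%N by rewrite /k addnA subnKC ?(ltnW aq) // addnC.
  by rewrite -(modn_small aq) -(modn_small cq) -(modnDr c) -e -modnDmr k0 addn0.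
have : generator <[s]>%g (s ^+ k)%g.
  rewrite generator_coprime; apply: coprime_dvdl qk; by rewrite order_dvdn sq.
rewrite /generator => /eqP e; have : s \in <[s]>%g by apply: cycle_id.
by rewrite e; apply: subsetP; rewrite cycle_subG.
Qed.

Section Columns.
Variables (F : fieldType) (G : finGroupType).
Local Notation gb := (gb F).
Implicit Types (x y e : galg F G) (M : galg F (G * G)%type).

Lemma tn_cols M : M = \sum_k tn (lleg M k) (gb k).
Proof.
rewrite {1}(tn_sum M) exchange_big; apply: eq_bigr => k _.
rewrite -[RHS]/(tnr (gb k) _) (lleg_gb M) linear_sum; apply: eq_bigr => h _.
by rewrite linearZ.
Qed.

Lemma tn_rows M : M = \sum_h tn (gb h) (rleg M h).
Proof.
rewrite {1}(tn_sum M); apply: eq_bigr => h _.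
by rewrite (rleg_gb M) linear_sum; apply: eq_bigr => k _; rewrite linearZ.
Qed.

Lemma lleg_tn x y k : lleg (tn x y) k = y k *: x.
Proof. by apply/ffunP=> h; rewrite llegE tnE gscaleE mulrC. Qed.

Lemma lleg_mul_tn M y k : lleg (M * tn y 1) k = lleg M k * y.
Proof.
rewrite {1}(tn_cols M) mulr_suml; apply/ffunP=> h; rewrite llegE gsumE.
rewrite (bigD1 k) //= big1 => [|l /negPf lk]; rewrite -tnM mulr1 tnE gbE.
  by rewrite addr0 eqxx mulr1.
by rewrite eq_sym lk mulr0.
Qed.

Lemma tn_central e : (forall x, e * x = x * e) ->
  (forall M, tn e 1 * M = M * tn e 1) /\ (forall M, tn 1 e * M = M * tn 1 e).
Proof.
move=> ce; split=> M; rewrite (tn_cols M) mulr_sumr mulr_suml; apply: eq_bigr => k _;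
  by rewrite -!tnM ?ce ?mul1r ?mulr1.
Qed.

End Columns.

Section Chain.
Variables (F : fieldType) (q : nat) (z : F).
Hypotheses (zq : q.-primitive_root z) (qF : q%:R != 0 :> F) (q_pr : prime q).
Local Notation gb := (gb F).
Variables (G : finGroupType) (s1 s2 : G).
Hypotheses (s1q : (s1 ^+ q = 1)%g) (s2q : (s2 ^+ q = 1)%g) (s12 : commute s1 s2).
Local Notation J := (twJ q z s1 s2).
Local Notation K := (twK q z s1 s2).
Local Notation D := (twD q z s1 s2).
Local Notation S := (twS q z s1 s2).
Implicit Types x y a : galg F G.

Lemma twJ_idem : J = \sum_(a < q) tn (idem q z a (gb s1)) (gb (s2 ^+ a)).
Proof.
apply: eq_bigr => a _; rewrite -gbX pair1X -[RHS]mul1r.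
have -> : tn (idem q z a (gb s1)) (gb (s2 ^+ a)) =
  tn (idem q z a (gb s1)) 1 * gb (1%g, (s2 ^+ a)%g) :> galg F (G * G)%type.
  by rewrite -tn_gb -tnM gb1 mulr1 mul1r.
rewrite mul1r; congr (_ * _); rewrite /idem -[RHS]/(tnr 1 _) linearZ /=.
congr (_ *: _); rewrite -[RHS]/(tnr 1 _) linear_sum; apply: eq_bigr => i _.
rewrite linearZ /= -!gbX pairX1 /tnr.
by rewrite -gb1 tn_gb.
Qed.

Variables (e : galg F G) (N : {group G}).
Hypotheses (ce : forall x, e * x = x * e) (eN : forall g, e g != 0 -> g \in N)
  (Ne : forall g, g \in N -> gb g * e = e) (e1 : e 1%g != 0).

(** Left coinvariance: (t (x) t)(e (x) 1) = e (x) t since t e = e, and 1 (x) t commutes with J since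
    t commutes with s_2, so the twist cancels. *)
Lemma twD_coinv t : t \in N -> commute t s2 -> D (gb t) * tn e 1 = tn e (gb t).
Proof.
move=> tN ts2; have [cl _] := tn_central ce.
rewrite -mulrA -cl mulrA -[J * _ * _]mulrA dg_gb -tn_gb -tnM Ne // mulr1.
have -> : tn e (gb t) = gb (1%g, t) * tn e 1 by rewrite -tn_gb -tnM gb1 mul1r mulr1.
have -> : J * (gb (1%g, t) * tn e 1) = gb (1%g, t) * tn e 1 * J.
  rewrite -[RHS]mulrA [in RHS]cl !mulrA; congr (_ * _).
  by apply/esym/comm_bichar; apply/gb_comm/pair_comm => //;
    first [exact: commute1 | exact/commute_sym/commute1].
by rewrite -[LHS]mulrA twJK // mulr1.
Qed.

(** Right coinvariance amounts to J (t (x) e) = (t (x) 1) J (1 (x) e). When s_2 is not in N, the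
    cosets s_2^c N with c < q are distinct, so the second leg separates the spectral projectors of
    s_1: each commutes with t, hence so does s_1. *)
Lemma twD_coinv_mem t : t \in N -> D (gb t) * tn 1 e = tn (gb t) e ->
  s2 \notin N -> commute s1 t.
Proof.
move=> tN Dt s2N; have [_ cr] := tn_central ce.
have JT : J * tn (gb t) e = tn (gb t) 1 * J * tn 1 e.
  have -> : J * tn (gb t) e = D (gb t) * tn 1 e * J.
    rewrite -[RHS]mulrA cr mulrA /twD -[_ * K * J]mulrA twKJ // mulr1 dg_gb -tn_gb.
    by rewrite -mulrA -tnM mulr1 Ne.
  rewrite Dt -mulrA -cr mulrA; congr (_ * _).
  by rewrite -tnM mulr1 mul1r.
have idem_comm (c : 'I_q) : idem q z c (gb s1) * gb t = gb t * idem q z c (gb s1).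
  apply/ffunP=> g; apply: (mulIf e1).
  (* The element s_2^a e is supported in s_2^a N, so evaluating the second leg at s_2^c retains only
     a = c. *)
  have coefJ (f : galg F G -> galg F G) (u : 'I_q -> galg F (G * G)%type) :
    (forall a : 'I_q, u a = tn (f (idem q z a (gb s1))) (gb (s2 ^+ a) * e)) ->
    (\sum_(a < q) u a) (g, (s2 ^+ c)%g) = f (idem q z c (gb s1)) g * e 1%g.
    move=> ue; rewrite gsumE (bigD1 c) //= big1 => [|a ac].
      by rewrite /= addr0 ue tnE gbmulE mulVg.
    rewrite ue tnE gbmulE; apply/eqP; rewrite mulf_eq0; apply/orP; right.
    by apply: contraR s2N => /eN; apply: (expg_prime_mem q_pr s2q).
  move/ffunP/(_ (g, (s2 ^+ c)%g)): JT; rewrite twJ_idem mulr_suml mulr_sumr mulr_suml.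
  rewrite (coefJ ( *%R^~ (gb t))) => [|a]; last by rewrite -tnM.
  by rewrite (coefJ ( *%R (gb t))) // => a; rewrite -!tnM mul1r mulr1.
have s1E : gb s1 = \sum_(c < q) z ^- c *: idem q z c (gb s1).
  rewrite -[LHS]mulr1 -(sum_idem zq qF (gb s1)) mulr_sumr; apply: eq_bigr => c _.
  by rewrite -[X in X * _]expr1 (expr_idem zq) ?muln1 ?gb_expq.
have : gb s1 * gb t = gb t * gb s1.
  rewrite s1E mulr_suml mulr_sumr; apply: eq_bigr => c _.
  by rewrite -scalerAl -scalerAr idem_comm.
rewrite -!gbM => /ffunP/(_ (s1 * t)%g); rewrite !gbE eqxx.
by case: eqP => // _ /eqP; rewrite oner_eq0.
Qed.

Variables (m : nat) (b : 'I_m -> galg F G).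
Local Notation inB := (lspan b).
Hypotheses (BS : forall x, inB x -> inB (S x))
  (Brow : forall x k, inB x -> inB (rleg (D x) k)).
Hypotheses (Be : inB e) (xe : forall x, inB x -> x * e = geps x *: e).

(** The element lam(e a_1) S(a_2) lies in B because e does; coinvariance evaluates it to lam(e)
    S(a). So S(a), and then a = S(S a), is in B. *)
Lemma coinv_lspan a : D a * tn e 1 = tn e a -> inB a.
Proof.
move=> Da; rewrite -(twSK zq qF s1q s2q s12 a); apply: BS.
have : inB (lamS q z s1 s2 a e) by exact: lamS_in.
rewrite lamSE //.
have -> : \sum_k (e * lleg (D a) k) 1%g *: S (gb k) = e 1%g *: S a.
  rewrite {2}(gb_sum a) linear_sum scaler_sumr; apply: eq_bigr => k _.
  by rewrite linearZ scalerA gmul_tr -lleg_mul_tn Da lleg_tn gscaleE mulrC.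
by move/(lspanZ (e 1%g)^-1); rewrite scalerA mulVf // scale1r.
Qed.

(** The right legs of D x lie in B, where e absorbs them through eps; the counit axiom then restores
    x. *)
Lemma lspan_coinv x : inB x -> D x * tn 1 e = tn x e.
Proof.
move=> Bx; rewrite {1}(tn_rows (D x)) mulr_suml.
rewrite {2}(gb_sum x) -[RHS]/(tnr e _) linear_sum; apply: eq_bigr => h _.
rewrite linearZ /= -tnM mulr1 xe; last exact: Brow.
rewrite linearZ /tnr; congr (_ *: _); rewrite -(twD_fst zq qF s1 s2).
by apply: eq_bigr => k _; rewrite rlegE.
Qed.

Lemma chain t : t \in N -> commute t s2 -> ~ commute t s1 -> s2 \in N.
Proof.
move=> tN ts2 ts1; apply: contraT => s2N; case: ts1; apply: commute_sym.
apply: twD_coinv_mem => //; apply: lspan_coinv => //.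
by apply: coinv_lspan; apply: twD_coinv.
Qed.

End Chain.

(** * Simplicity *)

Section Simple.
Variables (F : fieldType) (q : nat) (z : F).
Hypotheses (zq : q.-primitive_root z) (qF : q%:R != 0 :> F) (q_pr : prime q).
Local Notation gb := (gb F).
Local Notation R := (bichar q z).

Definition swap (G : finGroupType) (u : G * G) : G * G := (u.2, u.1).

Lemma swap_coef (G : finGroupType) (M : galg F (G * G)%type) g h :
  gmap (@swap G) M (g, h) = M (h, g).
Proof.
have -> : gmap (@swap G) M = \sum_u M u *: gb (swap u) by [].
rewrite gsumE (bigD1 (h, g)) //= big1 => [|[h' g'] ne].
  by rewrite addr0 gscaleE gbE eqxx mulr1.
rewrite gscaleE gbE /swap /=; case: eqP => [[gg hh]|]; last by rewrite mulr0.
by case/eqP: ne; rewrite gg hh.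
Qed.

Variables (G : finGroupType) (s1 s2 : G).
Hypotheses (s1q : (s1 ^+ q = 1)%g) (s2q : (s2 ^+ q = 1)%g) (s12 : commute s1 s2).
Hypothesis G0 : #|G|%:R != 0 :> F.
Local Notation D := (twD q z s1 s2).
Local Notation S := (twS q z s1 s2).
Implicit Types x y a : galg F G.

(** The bicharacter is symmetric, so flipping the legs exchanges the roles of s_1 and s_2. This lets
    [chain] serve for t_2 as well. *)
Lemma swap_twD x : gmap (@swap G) (D x) = twD q z s2 s1 x.
Proof.
have sM : {morph @swap G : g h / (g * h)%g} by [].
have c12 : commute ((s2, 1%g) : (G * G)%type) (1%g, s1) by exact: comm_s1s2.
have s1Q : ((1%g, s1) ^+ q = 1 :> G * G)%g by rewrite pair1X s1q.
have s2Q : ((s2, 1%g) ^+ q = 1 :> G * G)%g by rewrite pairX1 s2q.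
rewrite /twD !gmapM // /twJ /twK !gmap_bichar //= /swap /=; congr (_ * _ * _).
- by apply: bichar_sym; apply/gb_comm/commute_sym.
- by rewrite gmap_comp.
have -> : (s2^-1%g, 1%g) = (s2, 1)^-1%g :> (G * G)%type by congr (_, _); rewrite invg1.
have -> : (1%g, s1^-1%g) = (1, s1)^-1%g :> (G * G)%type by congr (_, _); rewrite invg1.
rewrite -(bicharVV zq qF s1Q s2Q (commute_sym c12)).
by apply: bichar_sym; apply: gb_comm; exact/commute_sym/commuteV.
Qed.

Lemma swap_twS x : twS q z s2 s1 x = S x.
Proof.
rewrite /twS /twQ /twP -(bichar_sym q z (gb_comm F s12)).
by rewrite -(bicharVV zq qF s2q s1q (commute_sym s12)) -(bichar_sym _ _ (gb_comm F (commuteV s12))).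
Qed.

Variables (m : nat) (b : 'I_m -> galg F G).
Local Notation inB := (lspan b).
Hypotheses (B1 : inB 1) (BM : forall x y, inB x -> inB y -> inB (x * y))
  (BS : forall x, inB x -> inB (S x))
  (Brow : forall x k, inB x -> inB (rleg (D x) k))
  (Bcol : forall x k, inB x -> inB (lleg (D x) k)).

Definition had (h x : galg F G) : galg F G :=
  \sum_c \sum_d D h (c, d) *: (gb c * x * S (gb d)).

(** The identity h x = (h_1 x S(h_2)) h_3, from coassociativity and the antipode axiom. *)
Lemma hadE h x : h * x = \sum_u \sum_v D h (u, v) *: (had (gb u) x * gb v).
Proof.
apply/esym; transitivity (\sum_u \sum_v \sum_c \sum_d
   (D h (u, v) * D (gb u) (c, d)) *: (gb c * x * (S (gb d) * gb v))).
  apply: eq_bigr => u _; apply: eq_bigr => v _.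
  rewrite mulr_suml scaler_sumr; apply: eq_bigr => c _.
  rewrite mulr_suml scaler_sumr; apply: eq_bigr => d _.
  by rewrite -scalerAl scalerA -!mulrA.
transitivity (\sum_v \sum_c \sum_d
   (\sum_u D h (u, v) * D (gb u) (c, d)) *: (gb c * x * (S (gb d) * gb v))).
  rewrite exchange_big; apply: eq_bigr => v _.
  rewrite exchange_big; apply: eq_bigr => c _.
  by rewrite exchange_big; apply: eq_bigr => d _; rewrite scaler_suml.
transitivity (\sum_c \sum_u D h (c, u) *: (gb c * x *
    \sum_d \sum_v D (gb u) (d, v) *: (S (gb d) * gb v))).
  rewrite exchange_big; apply: eq_bigr => c _.
  under eq_bigr => v _ do under eq_bigr => d _ do
    rewrite twD_coassoc_coef // scaler_suml.
  under [LHS]eq_bigr do rewrite exchange_big.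
  rewrite exchange_big; apply: eq_bigr => u _.
  rewrite exchange_big mulr_sumr scaler_sumr; apply: eq_bigr => d _.
  rewrite mulr_sumr scaler_sumr; apply: eq_bigr => v _.
  by rewrite -scalerAr scalerA.
rewrite {2}(gb_sum h) mulr_suml; apply: eq_bigr => c _.
rewrite -(twD_fst zq qF s1 s2) scaler_suml mulr_suml; apply: eq_bigr => u _.
by rewrite antipode_l // geps_gb scale1r mulr1 scalerAl.
Qed.

Lemma geps_had g x : geps (had (gb g) x) = geps x.
Proof.
transitivity (\sum_c \sum_d D (gb g) (c, d) * geps x).
  rewrite linear_sum; apply: eq_bigr => c _; rewrite linear_sum; apply: eq_bigr => d _.
  by rewrite linearZ /= gepsM geps_twS // gepsM !geps_gb mul1r mulr1.
under eq_bigr => c _ do rewrite -mulr_suml twD_fst //.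
by rewrite -mulr_suml -[X in X * _]/(geps (gb g)) geps_gb mul1r.
Qed.

Lemma coinv_of_absorb e x : (forall k, lleg (D x) k * e = geps (lleg (D x) k) *: e) ->
  D x * tn e 1 = tn e x.
Proof.
move=> xe; rewrite {1}(tn_cols (D x)) mulr_suml {2}(gb_sum x) linear_sum; apply: eq_bigr => k _.
rewrite linearZ /= -tnM mulr1 xe.
rewrite -[LHS]/(tnr (gb k) _) linearZ; congr (_ *: _).
by rewrite -(twD_snd zq qF s1 s2); apply: eq_bigr => h _; rewrite llegE.
Qed.

Hypothesis Bad : forall h x, inB x -> inB (had h x).

Section Integral.
Variable e : galg F G.
Hypotheses (Be : inB e) (e_eps : geps e = 1)
  (ex : forall x, inB x -> e * x = geps x *: e) (xe : forall x, inB x -> x * e = geps x *: e).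

Lemma integral_central h : e * h = h * e.
Proof.
have ehe k : e * k * (1 - e) = 0.
  have Bx : inB (1 - e).
    by rewrite -scaleN1r; apply: lspanD => //; apply: lspanZ.
  rewrite -mulrA (hadE k) mulr_sumr big1 // => u _.
  rewrite mulr_sumr big1 // => v _.
  rewrite -scalerAr mulrA ex ?geps_had; last exact: Bad.
  by rewrite linearB /= e_eps geps1 subrr scale0r mul0r scaler0.
have : (1 - e) * (h * e) = 0.
  apply/ffunP=> g; rewrite [RHS]ffunE.
  have -> : ((1 - e) * (h * e)) g = ((1 - e) * (h * e * gb g^-1)) 1%g.
    by rewrite !mulrA mulgbE invgK mul1g.
  by rewrite gmul_tr -!mulrA (mulrA e) ehe mulr0 ffunE.
rewrite mulrBl mul1r mulrA => /subr0_eq->.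
by have := ehe h; rewrite mulrBr mulr1 => /subr0_eq.
Qed.

Lemma integral_supp g : e g != 0 -> gb g * e = e.
Proof.
have [cl _] := tn_central integral_central.
have ce2 M : tn e e * M = M * tn e e.
  rewrite (tn_cols M) mulr_sumr mulr_suml; apply: eq_bigr => k _.
  by rewrite -!tnM !integral_central.
have : dg e * tn e 1 = tn e e.
  have -> : dg e * tn e 1 = twK q z s1 s2 * (D e * tn e 1) * twJ q z s1 s2.
    rewrite /twD -[_ * _ * tn e 1]mulrA -(cl (twK _ _ _ _)) !mulrA twKJ // mul1r.
    by rewrite -[RHS]mulrA twKJ // mulr1.
  have De : D e * tn e 1 = tn e e by apply: coinv_of_absorb => k; exact/xe/Bcol.
  by rewrite De -mulrA ce2 mulrA twKJ // mul1r.
move=> E eg; have : lleg (dg e * tn e 1) g = e g *: (gb g * e).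
  rewrite lleg_mul_tn scalerAl; congr (_ * _); apply/ffunP=> h.
  have -> : dg e = \sum_k e k *: gb (k, k) by [].
  rewrite llegE gsumE (bigD1 g) //= big1 => [|k /negPf kg].
    by rewrite /= addr0 !gscaleE !gbE xpair_eqE eqxx andbT.
  by rewrite gscaleE gbE xpair_eqE eq_sym andbC eq_sym kg mulr0.
rewrite E lleg_tn => /(congr1 (fun x => (e g)^-1 *: x)).
by rewrite !scalerA mulVf // !scale1r.
Qed.

(** The normal subgroup N of the overview; by [integral_supp] it contains the support of e. *)
Definition stab := [set g | gb g * e == e].

Lemma group_set_stab : group_set stab.
Proof.
apply/group_setP; split=> [|g h]; first by rewrite inE gb1 mul1r.
by rewrite !inE => /eqP ge /eqP he; rewrite gbM -mulrA he ge.
Qed.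
Canonical stab_group := Group group_set_stab.

Lemma stab_normal : (stab <| [set: G])%g.
Proof.
rewrite /normal subsetT; apply/subsetP => g _; rewrite inE.
apply/subsetP=> k /imsetP[h]; rewrite inE => /eqP he ->.
rewrite inE conjgE !gbM -!mulrA -integral_central (mulrA (gb h)) he integral_central.
by rewrite mulrA gbVl mul1r.
Qed.

(** Any g in the support has g e = e, so e(g) = e(1). If e(1) = 0, then e = 0, against eps(e) =
    1. *)
Lemma integral_coef1 : e 1%g != 0.
Proof.
apply: contra_eq_neq e_eps => e1; rewrite /geps big1 1?eq_sym ?oner_eq0 // => g _.
apply/eqP; apply: contraTT isT => eg; have := integral_supp eg.
by move/ffunP/(_ g); rewrite gbmulE mulVg e1 => eg0; rewrite -eg0 eqxx in eg.
Qed.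

End Integral.

Theorem lspan_trivial t1 t2 :
  commute t1 s2 -> ~ commute t1 s1 -> commute t2 s1 -> ~ commute t2 s2 ->
  (forall N : {group G}, (N <| [set: G])%g -> (t1 \in N -> s2 \in N) ->
     (t2 \in N -> s1 \in N) -> N :=: 1%g \/ N :=: [set: G]%g) ->
  (forall x, inB x -> x = (geps x)%:A) \/ (forall x, inB x).
Proof.
move=> t1s2 t1s1 t2s1 t2s2 GN.
have [e [Be ee ex xe]] :=
  exists_integral zq qF s1q s2q s12 G0 B1 BM BS Brow Bcol.
have ce := integral_central Be ee ex.
have eS := integral_supp Be ee ex xe.
have e1 := integral_coef1 Be ee ex xe.
pose N := stab_group e.
have Ne g : g \in N -> gb g * e = e by rewrite inE => /eqP.
have eN g : e g != 0 -> g \in N by move=> /eS eg; rewrite inE eg.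
case: (GN N) => [||| N1 | NT].
- exact: stab_normal Be ee ex.
- by move=> t1N; apply: (chain zq qF q_pr s1q s2q s12 ce eN Ne e1 BS Brow Be xe t1N).
(* The same argument with s_1 and s_2 exchanged: the rows of the exchanged comultiplication are the
   columns of D. *)
- move=> t2N; apply: (chain zq qF q_pr s2q s1q (commute_sym s12) ce eN Ne e1 _ _ Be xe t2N) => //.
    by move=> x Bx; rewrite swap_twS; exact: BS.
  move=> x k Bx; have -> : rleg (twD q z s2 s1 x) k = lleg (D x) k; last exact: Bcol.
  by apply/ffunP=> h; rewrite llegE rlegE -swap_twD swap_coef.
- left=> x Bx.
  (* For N = 1, e is a scalar of counit 1, so x = x e = eps(x) 1 on B. *)
  suff eE : e = 1 by have := xe x Bx; rewrite eE mulr1.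
  have eE : e = e 1%g *: 1.
    apply/ffunP=> g; rewrite gscaleE -gb1 gbE; case: eqP => [->|]; rewrite ?mulr1 //.
    move=> g1; rewrite mulr0; apply/eqP; apply: contraT => /eN.
    by rewrite N1 => /set1P.
  by rewrite eE; move: ee; rewrite {1}eE linearZ /= geps1 mulr1 => ->; rewrite scale1r.
(* For N = G every group element fixes e, so every x is coinvariant and hence in B. *)
right=> x; apply: (coinv_lspan zq qF s1q s2q s12 e1 BS Brow Be) => //.
apply: coinv_of_absorb => k; move: (lleg _ _) => y.
rewrite {1}(gb_sum y) mulr_suml /geps scaler_suml; apply: eq_bigr => g _.
by rewrite -scalerAl Ne // NT inE.
Qed.

End Simple.

(** * Structure constants *)

Section Coordinates.
Variables (F : fieldType) (G : finGroupType).
Local Notation gb := (gb F).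
Local Notation n := #|G|.

Definition vG (x : 'rV[F]_n) : galg F G := [ffun g => x 0 (enum_rank g)].
Definition gV (x : galg F G) : 'rV[F]_n := \row_i x (enum_val i).
Definition mG (M : 'M[F]_n) : galg F (G * G)%type :=
  [ffun u => M (enum_rank u.1) (enum_rank u.2)].
Definition gM (M : galg F (G * G)%type) : 'M[F]_n :=
  \matrix_(i, j) M (enum_val i, enum_val j).

Lemma vGE x i : vG x (enum_val i) = x 0 i. Proof. by rewrite ffunE enum_valK. Qed.
Lemma mGE M i j : mG M (enum_val i, enum_val j) = M i j.
Proof. by rewrite ffunE !enum_valK. Qed.
Lemma gVK : cancel gV vG.
Proof. by move=> x; apply/ffunP=> g; rewrite ffunE mxE enum_rankK. Qed.
Lemma vGK : cancel vG gV.
Proof. by move=> x; apply/rowP=> i; rewrite mxE vGE. Qed.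
Lemma gMK : cancel gM mG.
Proof. by move=> x; apply/ffunP=> -[g h]; rewrite ffunE mxE !enum_rankK. Qed.
Lemma mGK : cancel mG gM.
Proof. by move=> x; apply/matrixP=> i j; rewrite mxE mGE. Qed.

Fact vG_linear : linear vG.
Proof. by move=> a x y; apply/ffunP=> g; rewrite gaddE gscaleE !ffunE !mxE. Qed.
HB.instance Definition _ := GRing.isLinear.Build F 'rV[F]_n (galg F G) _ vG vG_linear.
Fact mG_linear : linear mG.
Proof. by move=> a x y; apply/ffunP=> g; rewrite gaddE gscaleE !ffunE !mxE. Qed.
HB.instance Definition _ := GRing.isLinear.Build F 'M[F]_n (galg F (G * G)%type) _ mG mG_linear.

Lemma sum_enum_val (V : nmodType) (f : G -> V) : \sum_(i < n) f (enum_val i) = \sum_g f g.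
Proof. by rewrite [RHS](reindex (@enum_val G G)) //; exact/onW_bij/enum_val_bij. Qed.

Lemma vG_sum x : vG x = \sum_i x 0 i *: gb (enum_val i).
Proof.
rewrite (gb_sum (vG x)) -(sum_enum_val (fun g => vG x g *: gb g)).
by apply: eq_bigr => i _; rewrite vGE.
Qed.

Lemma vG_bvec i : vG (bvec F i) = gb (enum_val i).
Proof.
apply/ffunP=> g; rewrite ffunE gbE mxE eqxx /=; congr (_%:R); congr nat_of_bool.
by rewrite -(inj_eq enum_val_inj) enum_rankK.
Qed.

Lemma mG_tens u v : mG (tens u v) = tn (vG u) (vG v).
Proof.
by apply/ffunP=> -[g h]; rewrite tnE !ffunE /= mxE big_ord1 mxE.
Qed.

Lemma mG_sum M : mG M = \sum_i \sum_j M i j *: gb (enum_val i, enum_val j).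
Proof.
rewrite (tn_sum (mG M)) -sum_enum_val; apply: eq_bigr => i _.
rewrite -sum_enum_val; apply: eq_bigr => j _; by rewrite mGE tn_gb.
Qed.

End Coordinates.

(** * The twisted group algebra as a [hopf] record *)

Section TwistedHopf.
Variables (F : fieldType) (q : nat) (z : F).
Hypotheses (zq : q.-primitive_root z) (qF : q%:R != 0 :> F) (q_pr : prime q).
Local Notation gb := (gb F).
Variables (G : finGroupType) (s1 s2 : G).
Hypotheses (s1q : (s1 ^+ q = 1)%g) (s2q : (s2 ^+ q = 1)%g) (s12 : commute s1 s2).
Hypothesis G0 : #|G|%:R != 0 :> F.
Local Notation D := (twD q z s1 s2).
Local Notation S := (twS q z s1 s2).
Local Notation n := #|G|.

Definition twhopf : hopf F n := @Hopf F n
  (fun i j => gV (gb (enum_val i * enum_val j))) (gV 1)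
  (fun i => gM (D (gb (enum_val i)))) (fun _ => 1)
  (\matrix_i gV (S (gb (enum_val i)))).
Local Notation H := twhopf.
Implicit Types x y : 'rV[F]_n.

Lemma vG_mulv x y : vG (mulv H x y) = vG x * vG y.
Proof.
rewrite /mulv linear_sum [in RHS]vG_sum mulr_suml; apply: eq_bigr => i _.
rewrite linear_sum [in RHS]vG_sum mulr_sumr; apply: eq_bigr => j _.
by rewrite linearZ /= gVK gbM -scalerAr -scalerAl scalerA mulrC.
Qed.

Lemma mG_comulv x : mG (comulv H x) = D (vG x).
Proof.
rewrite /comulv vG_sum !linear_sum; apply: eq_bigr => i _.
by rewrite !linearZ /= gMK.
Qed.

Lemma counitvE x : counitv H x = geps (vG x).
Proof.
rewrite vG_sum linear_sum; apply: eq_bigr => i _.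
by rewrite linearZ /= geps_gb.
Qed.

Lemma vG_antiv x : vG (antiv H x) = S (vG x).
Proof.
rewrite [in RHS]vG_sum linear_sum /antiv mulmx_sum_row linear_sum; apply: eq_bigr => i _.
by rewrite !linearZ /= rowK gVK.
Qed.

Lemma mG_tmul M N : mG (tmul H M N) = mG M * mG N.
Proof.
rewrite /tmul linear_sum [in RHS]mG_sum mulr_suml; apply: eq_bigr => a _.
rewrite linear_sum mulr_suml; apply: eq_bigr => b _.
rewrite linear_sum [in RHS]mG_sum mulr_sumr; apply: eq_bigr => c _.
rewrite linear_sum mulr_sumr; apply: eq_bigr => d _.
rewrite linearZ /= mG_tens !gVK -scalerAr -scalerAl scalerA mulrC; congr (_ *: _).
by rewrite -gbM tn_gb.
Qed.

Lemma vG_inj : injective (@vG F G). Proof. exact: can_inj (@vGK F G). Qed.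
Lemma mG_inj : injective (@mG F G). Proof. exact: can_inj (@mGK F G). Qed.

Lemma comulvE x i j : comulv H x i j = D (vG x) (enum_val i, enum_val j).
Proof. by rewrite -mG_comulv mGE. Qed.

Lemma twhopf_is_hopf : is_hopf H.
Proof.
split.
- split=> [x y w|x]; first by apply: vG_inj; rewrite !vG_mulv mulrA.
  by split; apply: vG_inj; rewrite vG_mulv gVK ?mul1r ?mulr1.
- split=> [x c d e|x].
    under eq_bigr do rewrite comulvE mxE.
    under [RHS]eq_bigr do rewrite comulvE mxE.
    rewrite (sum_enum_val (fun a => D (vG x) (a, enum_val e) * D (gb a) (enum_val c, enum_val d))).
    rewrite (sum_enum_val (fun a => D (vG x) (enum_val c, a) * D (gb a) (enum_val d, enum_val e))).
    exact: twD_coassoc_coef.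
  split; apply/rowP=> k; rewrite summxE -vGE.
    rewrite -(twD_snd zq qF s1 s2) -sum_enum_val; apply: eq_bigr => a _.
    by rewrite !mxE mul1r comulvE.
  rewrite -(twD_fst zq qF s1 s2) -sum_enum_val; apply: eq_bigr => a _.
  by rewrite !mxE mul1r comulvE.
- split=> [x y|]; apply: mG_inj.
    by rewrite mG_tmul !mG_comulv vG_mulv twDM.
  by rewrite mG_comulv mG_tens gVK twD1 // tn11.
- split=> [x y|]; first by rewrite !counitvE vG_mulv gepsM.
  by rewrite counitvE gVK geps1.
move=> x; split; apply: vG_inj; rewrite linearZ /= gVK counitvE.
  rewrite -(antipode_l zq qF s1q s2q s12) linear_sum -sum_enum_val.
  apply: eq_bigr => a _; rewrite linear_sum -sum_enum_val; apply: eq_bigr => c _.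
  by rewrite linearZ /= vG_mulv vG_antiv !vG_bvec comulvE.
rewrite -(antipode_r zq qF s1q s12) linear_sum -sum_enum_val.
apply: eq_bigr => a _; rewrite linear_sum -sum_enum_val; apply: eq_bigr => c _.
by rewrite linearZ /= vG_mulv vG_antiv !vG_bvec comulvE.
Qed.

(** Row vectors are acted on from the right, so left multiplication by g^-1 is what makes [lreg]
    multiplicative. *)
Definition lreg (g : G) : 'M[F]_n := \matrix_i gV (gb g^-1 * gb (enum_val i)).

Lemma vG_lreg x g : vG (x *m lreg g) = gb g^-1 * vG x.
Proof.
rewrite [in RHS]vG_sum mulr_sumr mulmx_sum_row linear_sum; apply: eq_bigr => i _.
by rewrite linearZ /= rowK gVK scalerAr.
Qed.

Fact lreg_repr : mx_repr [set: G] lreg.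
Proof.
split=> [|g h _ _]; apply/row_matrixP=> i.
  by apply: vG_inj; rewrite !rowE vG_lreg invg1 mul1r mulmx1.
by apply: vG_inj; rewrite !rowE mulmxA !vG_lreg invMg gbM mulrA.
Qed.
Definition lreg_representation := MxRepresentation lreg_repr.

(** The twist leaves the product unchanged, so left ideals are submodules of the regular
    representation and Maschke's theorem supplies a complement. *)
Lemma twhopf_semisimple : semisimple H.
Proof.
move=> I lI; have pG : ([pchar F]^'.-group [set: G])%g.
  by rewrite /pgroup cardsT pcharf'_nat.
have modI : mxmodule lreg_representation I.
  apply/mxmoduleP=> g _; apply/row_subP=> i; rewrite row_mul.
  suff -> : row i I *m lreg g = mulv H (gV (gb g^-1)) (row i I) by apply/lI/row_sub.
  by apply: vG_inj; rewrite vG_lreg vG_mulv gVK.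
have [J modJ IJ dIJ] := mx_Maschke_pchar lreg_representation pG modI (submx1 I).
exists J; split.
  move=> x y yJ; have -> : mulv H x y = \sum_i x 0 i *: (y *m lreg (enum_val i)^-1).
    apply: vG_inj; rewrite vG_mulv linear_sum [vG x]vG_sum mulr_suml.
    by apply: eq_bigr => i _; rewrite linearZ /= vG_lreg invgK scalerAl.
  apply: summx_sub => i _; apply: scalemx_sub; apply: submx_trans (submxMr _ yJ) _.
  by move/mxmoduleP: modJ; apply; rewrite inE.
split; first by apply/eqP/mxdirect_addsP.
exact/eqmxP.
Qed.

Section Simple.
Variable B : 'M[F]_n.
Definition rows i := vG (row i B).

Lemma rowsP x : reflect (lspan rows (vG x)) (x <= B)%MS.
Proof.
apply: (iffP submxP) => [[c ->]|[c e]].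
  exists (c 0); rewrite mulmx_sum_row linear_sum; apply: eq_bigr => i _.
  by rewrite linearZ.
exists (\row_i c i); apply: vG_inj; rewrite e mulmx_sum_row linear_sum.
by apply: eq_bigr => i _; rewrite linearZ mxE.
Qed.
End Simple.

Variables t1 t2 : G.
Hypotheses (t1s2 : commute t1 s2) (t1s1 : ~ commute t1 s1)
  (t2s1 : commute t2 s1) (t2s2 : ~ commute t2 s2).
Hypothesis GN : forall N : {group G}, (N <| [set: G])%g -> (t1 \in N -> s2 \in N) ->
     (t2 \in N -> s1 \in N) -> N :=: 1%g \/ N :=: [set: G]%g.

Lemma twhopf_simple : simple_hopf H.
Proof.
move=> B [B1 BM Bco BS] Bad.
have inB u : (gV u <= B)%MS <-> lspan (rows B) u.
  by rewrite -{2}(gVK u); split=> /rowsP.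
have [|||||| Btriv|Bfull] := @lspan_trivial F q z zq qF q_pr G s1 s2 s1q s2q s12 G0 _ (rows B)
  _ _ _ _ _ _ t1 t2 t1s2 t1s1 t2s1 t2s2 GN.
- exact/inB.
- move=> u v /inB Bu /inB Bv; apply/inB; have := BM _ _ Bu Bv.
  by congr (_ <= _)%MS; apply: vG_inj; rewrite vG_mulv !gVK.
- move=> u /inB Bu; apply/inB; have := BS _ Bu.
  by congr (_ <= _)%MS; apply: vG_inj; rewrite vG_antiv !gVK.
- move=> u k /inB Bu; apply/inB; have [/row_subP/(_ (enum_rank k)) + _] := Bco _ Bu.
  congr (_ <= _)%MS; apply/rowP=> j; rewrite [LHS]mxE [RHS]mxE rlegE comulvE gVK.
  by rewrite enum_rankK.
- move=> u k /inB Bu; apply/inB; have [_ /row_subP/(_ (enum_rank k)) +] := Bco _ Bu.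
  congr (_ <= _)%MS; apply/rowP=> j; rewrite [LHS]mxE mxE [RHS]mxE llegE comulvE gVK.
  by rewrite enum_rankK.
- move=> h u /inB Bu; apply/inB; have := Bad (gV h) _ Bu.
  congr (_ <= _)%MS; apply: vG_inj; rewrite gVK /adv linear_sum /had -sum_enum_val.
  apply: eq_bigr => a _; rewrite linear_sum -sum_enum_val; apply: eq_bigr => c _.
  by rewrite linearZ /= !vG_mulv vG_antiv !vG_bvec comulvE !gVK.
- left; apply/andP; split=> //; apply/rV_subP=> x /rowsP/Btriv xe.
  have -> : x = geps (vG x) *: hunit H by apply: vG_inj; rewrite linearZ /= gVK.
  exact: scalemx_sub.
right; rewrite submx1; apply/row_subP=> i; exact/rowsP.
Qed.

(* If H were cocommutative, t1 would be coinvariant modulo N on both sides, and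
   would therefore commute with s1. *)
Lemma twhopf_not_group_algebra (N : {group G}) : (N <| [set: G])%g -> t1 \in N ->
  s2 \notin N -> ~ is_group_algebra H.
Proof.
move=> nN t1N s2N [gT [f [_ [P [Pu [_ [_ [Pco _]]]]]]]].
(* A group algebra is cocommutative, and the congruence by [P] preserves symmetric matrices. *)
have sym x : (comulv H x)^T = comulv H x.
  rewrite -(mulmxKV Pu x) Pco !trmx_mul trmxK mulmxA; congr (_ *m _ *m _).
  rewrite /comulv linear_sum; apply: eq_bigr => i _; rewrite linearZ /=; congr (_ *: _).
  by apply/matrixP=> a c; rewrite !mxE andbC.
have DS : gmap (@swap G) (D (gb t1)) = D (gb t1).
  apply/ffunP=> -[g h]; rewrite swap_coef -(gVK (gb t1)) -(enum_rankK g) -(enum_rankK h).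
  by rewrite -!comulvE -[in RHS]sym mxE.
(* A multiple of the averaging idempotent of N, with coefficients 0 and 1; it plays the part of the
   integral in the coinvariance lemmas. *)
pose e : galg F G := \sum_(g in N) gb g.
have eE g : e g = (g \in N)%:R.
  rewrite gsumE; have [gN|gN] := boolP (g \in N).
    rewrite (bigD1 g) //= big1 => [|h /andP[_ /negPf hg]]; first by rewrite gbE eqxx addr0.
    by rewrite gbE eq_sym hg.
  by rewrite big1 // => h hN; rewrite gbE; case: eqP hN gN => // ->->.
have Ne g : g \in N -> gb g * e = e.
  by move=> gN; apply/ffunP=> h; rewrite gbmulE !eE groupMl ?groupV.
have ce u : e * u = u * e.
  rewrite (gb_sum u) mulr_sumr mulr_suml; apply: eq_bigr => g _.
  rewrite -scalerAr -scalerAl; congr (_ *: _); apply/ffunP=> h.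
  rewrite gbmulE mulgbE !eE; congr (_%:R); congr nat_of_bool.
  rewrite -[LHS](memJ_norm _ (_ : g \in 'N(N)%g)) ?conjgE ?mulgA ?mulgKV //.
  by move/normal_norm: nN => /subsetP; apply; rewrite inE.
have eN g : e g != 0 -> g \in N by rewrite eE; case: (g \in N); rewrite ?eqxx.
have e1 : e 1%g != 0 by rewrite eE group1 oner_eq0.
have Dt := twD_coinv zq qF s1q ce Ne t1N t1s2.
apply/t1s1/commute_sym/(twD_coinv_mem zq qF q_pr s1q s2q ce eN Ne e1 t1N _ s2N).
have sM : {morph @swap G : g h / (g * h)%g} by [].
have swtn (u v : galg F G) : gmap (@swap G) (tn u v) = tn v u.
  by apply/ffunP=> -[g h]; rewrite swap_coef !tnE mulrC.
by rewrite -(swtn e (gb t1)) -Dt gmapM // DS swtn.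
Qed.

(** The dual of a group algebra is commutative, whereas t_1 and s_1 do not commute in kG. *)
Lemma twhopf_not_dual : ~ is_dual_group_algebra H.
Proof.
move=> [gT [f [_ [P [Pu [Pm _]]]]]]; apply: t1s1.
have C x y : mulv H x y = mulv H y x.
  rewrite -(mulmxKV Pu x) -(mulmxKV Pu y) !Pm; congr (_ *m _).
  rewrite /mulv exchange_big; apply: eq_bigr => i _; apply: eq_bigr => j _.
  by rewrite mulrC; congr (_ *: _); apply/rowP=> k; rewrite !mxE andbC.
have := congr1 (@vG F G) (C (gV (gb t1)) (gV (gb s1))).
rewrite !vG_mulv !gVK -!gbM => /ffunP/(_ (t1 * s1)%g); rewrite !gbE eqxx.
by case: eqP => // _ /eqP; rewrite oner_eq0.
Qed.

End TwistedHopf.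

(** * The affine group *)

(** The pair (b, i) stands for x |-> w^i x + b. With q = n + 2 the exponents form the ring Z_q; [wn]
    is a parameter of the type because the group law needs w to have exponent q. *)
Definition aff (K : finFieldType) (n : nat) (w : K) (wn : w ^+ n.+2 = 1) : Type :=
  (K * 'I_n.+2)%type.

Section Affine.
Variables (K : finFieldType) (n : nat) (w : K) (wn : w ^+ n.+2 = 1).
Local Notation aff := (aff wn).
HB.instance Definition _ := Finite.on aff.

Definition aff_mul (u v : aff) : aff := (u.1 + w ^+ u.2 * v.1, u.2 + v.2).
Definition aff_one : aff := (0, 0).
Definition aff_inv (u : aff) : aff := (- (w ^- u.2 * u.1), - u.2).

Lemma expw0 : w != 0.
Proof. by apply: contra_eq_neq wn => ->; rewrite expr0n eq_sym oner_eq0. Qed.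

Lemma expwD (i j : 'I_n.+2) : w ^+ (i + j)%R = w ^+ i * w ^+ j.
Proof. by rewrite /= -exprD expr_mod. Qed.

Fact aff_mulA : associative aff_mul.
Proof.
move=> u v x; congr (_, _); rewrite /= ?addrA //.
by rewrite expwD mulrDr addrA mulrA.
Qed.
Fact aff_mul1 : left_id aff_one aff_mul.
Proof. by move=> [a i]; congr (_, _); rewrite /= ?mul1r add0r. Qed.
Fact aff_mulV : left_inverse aff_one aff_inv aff_mul.
Proof.
move=> [a i]; congr (_, _); rewrite /= ?addNr //.
have e : w ^+ (- i)%R * w ^+ i = 1 by rewrite -expwD addNr.
have -> : w ^+ (- i)%R = w ^- i by rewrite -[RHS]mul1r -e mulfK // expf_neq0 // expw0.
by rewrite addNr.
Qed.
HB.instance Definition _ := Finite_isGroup.Build aff aff_mulA aff_mul1 aff_mulV.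


Definition aff_t : aff := (1, 0).
Definition aff_s : aff := (0, 1).

Lemma aff_mulE (a b : K) (i j : 'I_n.+2) :
  (((a, i) : aff) * ((b, j) : aff))%g = ((a + w ^+ i * b, i + j) : aff) :> aff.
Proof. by []. Qed.

Lemma aff_invE (a : K) (i : 'I_n.+2) : ((a, i) : aff)^-1%g = (- (w ^- i * a), - i) :> aff.
Proof. by []. Qed.

Lemma aff_transX (a : K) k : (((a, 0) : aff) ^+ k)%g = (a *+ k, 0) :> aff.
Proof.
elim: k => // k IH; rewrite expgS IH aff_mulE expr0 mul1r addr0.
by congr (_, _); rewrite mulrS.
Qed.

Lemma aff_sX k : (aff_s ^+ k)%g = (0, k%:R) :> aff.
Proof.
elim: k => // k IH; rewrite expgS IH aff_mulE mulr0 addr0.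
by congr (_, _); rewrite mulrS.
Qed.

Lemma aff_s_order : (aff_s ^+ n.+2 = 1)%g.
Proof.
by rewrite aff_sX; congr (_, _); rewrite Zp_nat; apply: val_inj; rewrite /= modnn.
Qed.

Hypotheses (w1 : n.+2.-primitive_root w) (natK : forall a : K, exists k, a = k%:R).

Lemma aff_ts : ~ commute aff_t aff_s.
Proof.
rewrite /commute !aff_mulE => -[]; rewrite expr0 mul1r !add0r addr0 mulr1 expr1 => e.
have := eq_prim_root_expr w1 0 1; rewrite expr0 expr1.
by rewrite !modn_small // e eqxx.
Qed.

Lemma aff_decomp (x : aff) : exists k l, x = (aff_t ^+ k * aff_s ^+ l)%g.
Proof.
case: x => b i; have [k ->] := natK b; exists k, i.
by rewrite aff_transX aff_sX aff_mulE expr0 mul1r addr0 add0r natr_Zp.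
Qed.

(** A commutator of x with s, if x is a translation, or with t otherwise, is a nonzero translation
    by some c. Its k-th power is t when k represents c^-1, which [natK] permits. *)
Lemma aff_commutator (x : aff) : x != 1%g ->
  exists g k, aff_t = ((x * (g * x^-1 * g^-1)) ^+ k)%g.
Proof.
case: x => b i x1.
suff [g [c c0 e]] : exists g : aff, exists2 c : K, c != 0 &
    (((b, i) : aff) * (g * ((b, i) : aff)^-1 * g^-1))%g = (c, 0) :> aff.
  have [k ck] := natK c^-1; exists g, k.
  by rewrite e aff_transX -mulr_natr -ck mulfV.
have [i0|i0] := eqVneq i 0.
  exists aff_s, (b - w * b).
    rewrite -{1}[b]mul1r -mulrBl mulf_neq0 //.
      rewrite subr_eq0 -(expr0 w) -{2}(expr1 w) (eq_prim_root_expr w1) !modn_small //.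
    by apply: contraNneq x1 => ->; rewrite i0.
  rewrite i0 !aff_invE !aff_mulE /=; congr (_, _); last by rewrite !(oppr0, addr0, add0r) subrr.
  by rewrite !(expr0, expr1, invr1, mul1r, mulr0, oppr0, addr0, add0r) mulrN.
exists aff_t, (w ^+ i - 1).
  by rewrite subr_eq0 -(expr0 w) (eq_prim_root_expr w1) !modn_small.
rewrite !aff_invE !aff_mulE; congr (_, _); last by rewrite !(oppr0, addr0, add0r) subrr.
have ww : w ^+ i * w ^+ (- i)%R = 1 by rewrite -expwD subrr.
rewrite add0r expr0 !mul1r invr1 !mulrDr !mulrN !mulr1 ww mulrA.
by rewrite mulfV ?expf_neq0 ?expw0 // mul1r addrA [b + _]addrCA subrr addr0.
Qed.

End Affine.

(** * Normal subgroups of the square of the affine group *)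

Section AffineSquare.
Variables (K : finFieldType) (n : nat) (w : K) (wn : w ^+ n.+2 = 1).
Hypotheses (w1 : n.+2.-primitive_root w) (natK : forall a : K, exists k, a = k%:R).
Local Notation X := (aff wn).
Local Notation G := (X * X)%type.
Local Notation t := (aff_t wn).
Local Notation s := (aff_s wn).

(** A nontrivial component of an element of N puts the t of that factor into N. The hypothesis
    yields the s of the other factor, hence its t, hence the remaining s; these generate G. *)
Lemma aff2_normal (N : {group G}) : (N <| [set: G])%g ->
  ((t, 1%g) \in N -> (1%g, s) \in N) -> ((1%g, t) \in N -> (s, 1%g) \in N) ->
  N :=: 1%g \/ N :=: [set: G]%g.
Proof.
move=> nN ts st.
have conjN u g : u \in N -> (u * (g * u^-1 * g^-1))%g \in N.
  move=> uN; rewrite groupM //; have -> : (g * u^-1 * g^-1 = u^-1 ^ g^-1)%g.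
    by rewrite conjgE invgK mulgA.
  rewrite memJ_norm ?groupV //.
  by move/normal_norm: nN => /subsetP; apply; rewrite inE.
have t1N (x y : X) : (x, y) \in N -> x != 1%g -> (t, 1%g) \in N.
  move=> xyN /(aff_commutator w1 natK)[g [k e]].
  have := conjN _ (g, 1%g) xyN => /(groupX k).
  have -> : ((x, y) * ((g, 1) * (x, y)^-1 * (g, 1)^-1) = (x * (g * x^-1 * g^-1), 1) :> G)%g.
    by congr (_, _); rewrite /= mul1g invg1 mulg1 mulgV.
  by rewrite pairX1 -e.
have t2N (x y : X) : (x, y) \in N -> y != 1%g -> (1%g, t) \in N.
  move=> xyN /(aff_commutator w1 natK)[g [k e]].
  have := conjN _ (1%g, g) xyN => /(groupX k).
  have -> : ((x, y) * ((1, g) * (x, y)^-1 * (1, g)^-1) = (1, y * (g * y^-1 * g^-1)) :> G)%g.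
    by congr (_, _); rewrite /= mul1g invg1 mulg1 mulgV.
  by rewrite pair1X -e.
have s1 : s != 1%g by apply/eqP => e; case: (@aff_ts K n w wn w1); rewrite e; exact: commute1.
have full : (t, 1%g) \in N -> (1%g, t) \in N -> N :=: [set: G]%g.
  move=> t1 t2; apply/eqP; rewrite eqEsubset subsetT; apply/subsetP => -[x y] _.
  have [k [l ->]] := aff_decomp natK x; have [k' [l' ->]] := aff_decomp natK y.
  have -> : ((t ^+ k * s ^+ l, t ^+ k' * s ^+ l') =
     (t, 1) ^+ k * (s, 1) ^+ l * ((1, t) ^+ k' * (1, s) ^+ l') :> G)%g.
    by rewrite !pairX1 !pair1X; congr (_, _); rewrite /= ?mulg1 ?mul1g.
  by rewrite !groupM ?groupX // ?ts ?st.
have [N1|] := eqVneq (N : {set G}) 1%g; first by left.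
case/trivgPn => -[x y] xyN xy1; right.
have /orP[x1|y1] : (x != 1%g) || (y != 1%g).
  by rewrite -negb_and; apply: contra xy1 => /andP[/eqP-> /eqP->].
- by have t1 := t1N _ _ xyN x1; apply: full => //; apply: (t2N _ _ (ts t1)).
by have t2 := t2N _ _ xyN y1; apply: full => //; apply: (t1N _ _ (st t2)).
Qed.

End AffineSquare.

(** * Primitive roots of unity of prime order *)

Lemma prime_prim_root (F : fieldType) (z : F) q : prime q -> z ^+ q = 1 -> z != 1 ->
  q.-primitive_root z.
Proof.
move=> q_pr zq z1; have [m zm mq] := prim_order_exists (prime_gt0 q_pr) zq.
case/primeP: q_pr => _ /(_ _ mq)/orP[] /eqP mE; last by rewrite -mE.
by move/prim_expr_order: zm; rewrite mE expr1 => /eqP; rewrite (negPf z1).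
Qed.

(** A root of 1 + X + ... + X^(q-1) works: it is not 1, since the value at 1 is q, nonzero in
    characteristic 0. *)
Lemma closed_prim_root (F : closedFieldType) (q : nat) :
  [pchar F] =i pred0 -> prime q -> exists z : F, q.-primitive_root z.
Proof.
move=> ch q_pr; have q1 := prime_gt1 q_pr.
pose p : {poly F} := \sum_(i < q) 'X^i.
have sp : size p = q.
  have Xp : ('X - 1%:P) * p = 'X^q - 1 by rewrite polyC1 subrX1.
  have sX : size ('X^q - 1 : {poly F}) = q.+1 by rewrite -polyC1 size_XnsubC ?prime_gt0.
  have p0 : p != 0.
    by apply: contra_eq_neq sX => p0; rewrite -Xp p0 mulr0 size_poly0.
  by have := size_monicM (monicXsubC 1) p0; rewrite Xp sX size_XsubC => -[].
have [z pz] : exists z, root p z by apply/closed_rootP; rewrite sp neq_ltn q1 orbT.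
have zq : z ^+ q = 1.
  apply/eqP; rewrite -subr_eq0 subrX1; move/rootP: pz; rewrite /p horner_sum => pz.
  by under eq_bigr do rewrite -hornerXn; rewrite pz mulr0.
have z1 : z != 1.
  apply/eqP=> z1; move/rootP: pz; rewrite z1 /p horner_sum.
  under eq_bigr do rewrite hornerXn expr1n.
  rewrite sumr_const card_ord => q0.
  by have := ch q; rewrite !inE q_pr q0 eqxx.
by exists z; exact: prime_prim_root.
Qed.

(** Cauchy's theorem in the unit group of F_p, of order p - 1. *)
Lemma Fp_prim_root p q : prime p -> prime q -> (q %| p - 1)%N ->
  exists w : 'F_p, q.-primitive_root w.
Proof.
move=> p_pr q_pr qp.
have qG : (q %| #|[set: {unit 'F_p}]|)%N by rewrite card_finField_unit card_Fp // -subn1.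
have [u _ uq] := Cauchy q_pr qG.
exists (val u); apply: prime_prim_root => //.
  by rewrite -FinRing.val_unitX -uq expg_order.
apply: contraTneq (prime_gt1 q_pr) => u1.
by rewrite -uq (_ : u = 1%g) ?order1 //; exact: val_inj.
Qed.

(* The example of dimension p^2 q^2 *)
Local Close Scope ring_scope.

Theorem theorem4p5 (F : closedFieldType) (charF0 : [pchar F]%R =i pred0)
  (p q : nat) (hp : prime p) (hq : prime q) (hqp : q %| p - 1) :
  exists H : hopf F (p ^ 2 * q ^ 2),
    [/\ is_hopf H, semisimple H, simple_hopf H,
        ~ is_group_algebra H & ~ is_dual_group_algebra H].
Proof.
have [z zq] := closed_prim_root charF0 hq.
have [w wq] := Fp_prim_root hp hq hqp.
case: q hq hqp zq wq => [|[|n]] // q_pr _ zq wq.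
have wn := prim_expr_order wq.
pose X : finGroupType := aff wn; pose t : X := aff_t wn; pose s : X := aff_s wn.
pose G : finGroupType := (X * X)%type.
have natF0 m : (0 < m)%N -> (m%:R != 0 :> F)%R.
  by move=> m0; rewrite (proj1 (pcharf0P F) charF0) -lt0n.
have cG : #|G| = (p ^ 2 * n.+2 ^ 2)%N.
  have cX : #|X| = (p * n.+2)%N by rewrite (card_prod 'F_p 'I_n.+2) card_Fp // card_ord.
  by rewrite (card_prod X X) cX -expnMn.
have natK (a : 'F_p) : exists k, a = k%:R%R by exists a; rewrite natr_Zp.
have ts : ~ commute t s := @aff_ts _ _ _ wn wq.
have so : (s ^+ n.+2 = 1)%g := aff_s_order wn.
have c1 (x y : X) : commute ((x, 1%g) : G) (1%g, y).
  by apply: pair_comm; [apply: commute1 | apply/commute_sym/commute1].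
have s1q : ((s, 1%g) ^+ n.+2 = 1 :> G)%g by rewrite pairX1 so.
have s2q : ((1%g, s) ^+ n.+2 = 1 :> G)%g by rewrite pair1X so.
have qF := natF0 n.+2 isT.
have G0 : (#|G|%:R != 0 :> F)%R by apply: natF0; rewrite cG muln_gt0 !expn_gt0 prime_gt0.
have ts1 : ~ commute ((t, 1%g) : G) (s, 1%g) by move=> /(congr1 fst); exact: ts.
have ts2 : ~ commute ((1%g, t) : G) (1%g, s) by move=> /(congr1 snd); exact: ts.
have GN := @aff2_normal _ _ _ wn wq natK.
rewrite -cG; exists (twhopf n.+2 z ((s, 1%g) : G) (1%g, s)); split.
- exact: twhopf_is_hopf.
- exact: twhopf_semisimple.
- apply: (twhopf_simple zq qF q_pr s1q s2q _ G0 _ ts1 _ ts2 GN) => //.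
  exact/commute_sym.
(* The first factor X * 1 is normal, contains t_1 = (t, 1) and misses s_2 = (1, s). *)
- pose N := setX_group [group of [set: X]] [1 X]%G.
  apply: (twhopf_not_group_algebra zq qF q_pr s1q s2q (c1 t s) ts1 (N := N)).
  + apply/andP; split; first exact: subsetT.
    apply/subsetP => -[g h] _; rewrite inE; apply/subsetP => _ /imsetP[[x y] + ->].
    by rewrite !inE /= => /eqP->; rewrite mul1g mulVg.
  + by apply/setXP; rewrite in_setT set11.
  by apply/setXP => -[_ /set1P s1]; apply: ts; rewrite s1; exact: commute1.
exact: twhopf_not_dual ts1.
Qed.
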